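(* Let $V:\mathbb{R}\to\mathbb{R}$ be a twice continuously differentiable one-periodic Morse function with $N$ geometrically distinct local minima, let $(S_j)_{j\in\mathbb{Z}^d}$ satisfy conditions (A), (B), (C) of the context, and let $\omega\in\mathbb{R}^d\setminus\mathbb{Q}^d$. Then there is an $\varepsilon_1>0$ such that for all $0<\varepsilon\le\varepsilon_1$ the collection of laminations of solutions of rotation vector $\omega$ of $$V'(x_i)+\varepsilon\sum_{j\in\mathbb{Z}^d}\partial_iS_j(x)=0\quad\text{for all } i\in\mathbb{Z}^d ,$$ endowed with the vague topology described in the context, is homeomorphic to the $(N-1)$-dimensional simplex $$\Delta_{N-1}:=\{p\in\mathbb{R}^N \mid p_1+\ldots+p_N=1 \text{ and } p_j\ge 0 \text{ for all } 1\le j\le N\}.$$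
   Context: Setting. Fix $d\ge 1$. A configuration is a map $x:\mathbb{Z}^d\to\mathbb{R}$; the space of configurations $\mathbb{R}^{\mathbb{Z}^d}$ carries the topology of pointwise convergence. Put $\|i\|=\sum_{k=1}^d|i_k|$ for $i\in\mathbb{Z}^d$ and $B_r(j)=\{k\in\mathbb{Z}^d : \|k-j\|\le r\}$. For $k\in\mathbb{Z}^d$, $l\in\mathbb{Z}$ the translation $\tau_{k,l}:\mathbb{R}^{\mathbb{Z}^d}\to\mathbb{R}^{\mathbb{Z}^d}$ is $(\tau_{k,l}x)_i=x_{i+k}+l$. A one-periodic $C^2$ function $V$ is Morse if $V''\ne0$ at all its critical points. Two points $\sigma_1,\sigma_2\in\mathbb{R}$ are geometrically distinct if $\sigma_1-\sigma_2\notin\mathbb{Z}$. The functions $S_j:\mathbb{R}^{\mathbb{Z}^d}\to\mathbb{R}$ ($j\in\mathbb{Z}^d$) satisfy: (A) there is an integer $r>0$ and for each $j$ a twice continuously differentiable $s_j:\mathbb{R}^{B_r(j)}\to\mathbb{R}$ with $S_j(x)=s_j(x|_{B_r(j)})$; (B) $S_j(\tau_{k,l}x)=S_{j+k}(x)$ for all $j,k\in\mathbb{Z}^d$, $l\in\mathbb{Z}$; (C) $\partial_{i,k}S_j\le 0$ for all $j$ and all $i\ne k$, and $\partial_{i,k}S_i<0$ whenever $\|i-k\|=1$. Order. For $x\neq y$ write $x<y$ if $x_i\le y_i$ for all $i$. Two configurations are ordered if $x<y$, $x=y$ or $x>y$; a set of configurations is ordered if any two of its elements are. A configuration $x$ is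 Birkhoff if $\{\tau_{k,l}x : k\in\mathbb{Z}^d,l\in\mathbb{Z}\}$ is ordered. Laminations. A Cantor set is a topological space (here a subset of $\mathbb{R}^{\mathbb{Z}^d}$) that is closed, perfect (every element $c$ is a limit of points of the set different from $c$) and totally disconnected (any two distinct points can be separated by a decomposition of the set into two disjoint closed sets); compactness is not required. A collection $\Gamma\subset\mathbb{R}^{\mathbb{Z}^d}$ is a lamination if it is nonempty, ordered, invariant under all $\tau_{k,l}$, closed for pointwise convergence, minimal (it has no nonempty proper subset that is closed and translation-invariant) and homeomorphic to a Cantor set. Every lamination has a rotation vector: the unique $\omega\in\mathbb{R}^d$ (necessarily in $\mathbb{R}^d\setminus\mathbb{Q}^d$) with $\lim_{n\to\infty}x_{ni}/n=\omega\cdot i$ for all $x\in\Gamma$, $i\in\mathbb{Z}^d$. A lamination of solutions is a lamination all of whose elements solve the displayed equation. Topology on the set of laminations. Let $x$ be a Birkhoff configuration of rotation vector $\omega\in\mathbb{R}^d\setminus\mathbb{Q}^d$. Its lower hull function is $\phi_x^-(s)=\lim_n (x_{k_n}+l_n)$ for any $(k_n,l_n)\in\mathbb{Z}^d\times\mathbb{Z}$ with $\omega\cdot k_n+l_n<s$ and $\omega\cdot k_n+l_n\to s$; its upper hull function $\phi_x^+$ is defined in the same way with $\omega\cdot k_n+l_n>s$. These are nondecreasing, satisfy $\phi_x^\pm(s+1)=\phi_x^\pm(s)+1$, and coincide almost everywhere. Let $\mu_x$ be the Radon probability measure on $\mathbb{R}/\mathbb{Z}$ given by $\mu_x(f)=\int_{\mathbb{R}/\mathbb{Z}}f(\phi_x^{\pm}(s))\,ds$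 for $f\in C^0(\mathbb{R}/\mathbb{Z},\mathbb{R})$. The measure $\mu_x$ is the same for all elements $x$ of a lamination $\Gamma$, and $\Gamma\mapsto\mu_\Gamma:=\mu_x$ ($x\in\Gamma$) is injective on the laminations of rotation vector $\omega$. The set of laminations is given the topology induced, via $\Gamma\mapsto\mu_\Gamma$, by the vague topology on the space $M(\mathbb{R}/\mathbb{Z})$ of Radon probability measures on $\mathbb{R}/\mathbb{Z}$, i.e. the topology of convergence $\mu_n(f)\to\mu(f)$ for every continuous $f:\mathbb{R}/\mathbb{Z}\to\mathbb{R}$. *)

(* Defs.v *)
From HB Require Import structures.
From mathcomp Require Import all_boot all_order all_algebra.
From mathcomp Require Import all_classical all_reals all_analysis.

Set Implicit Arguments.
Unset Strict Implicit.
Unset Printing Implicit Defensive.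
Import Order.TTheory GRing.Theory Num.Theory.
Import numFieldNormedType.Exports.

Local Open Scope classical_set_scope.
Local Open Scope ring_scope.

Definition homeomorphic (X Y : topologicalType) : Prop :=
  exists (f : X -> Y) (g : Y -> X),
    [/\ cancel f g, cancel g f, continuous f & continuous g].

Notation config R d := {ptws 'rV[int]_d -> R}.

Section Calculus.
Context {R : realType}.

Definition C2_real (V : R -> R) : Prop :=
  [/\ forall x, derivable V x 1, forall x, derivable (derive1 V) x 1 &
      continuous (derive1n 2 V)].

Definition partial {I : eqType} (i : I) (f : {ptws I -> R} -> R)
    (x : {ptws I -> R}) : R :=
  derive1 (fun t : R => f (dfwith x i t)) (x i).

Definition has_partials {I : eqType} (f : {ptws I -> R} -> R) : Prop :=
  forall i x, derivable (fun t : R => f (dfwith x i t)) (x i) 1.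

(* Only used for finite [I], where [{ptws I -> R}] is a Euclidean space: all
   partial derivatives of order at most 2 exist and are continuous. *)
Definition C2 {I : eqType} (f : {ptws I -> R} -> R) : Prop :=
  [/\ continuous f,
      has_partials f /\ forall i, continuous (partial i f) &
      forall k, has_partials (partial k f) /\
                forall i, continuous (partial i (partial k f))].

Definition Morse (V : R -> R) : Prop :=
  forall x, derive1 V x = 0 -> derive1n 2 V x != 0.

Definition local_minimum (V : R -> R) (x : R) : Prop :=
  \forall y \near x, V x <= V y.

(* [V] has exactly [N] local minima modulo [Z]. *)
Definition has_N_minima (V : R -> R) (N : nat) : Prop :=
  exists m : 'I_N -> R,
    [/\ forall a, local_minimum V (m a),
        forall a b, a != b -> m a - m b \isn't a Num.int &
        forall x, local_minimum V x -> exists a, x - m a \is a Num.int].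

End Calculus.

Section Configurations.
Context {R : realType} {d : nat}.
Local Notation conf := (config R d).
Implicit Types (x y : conf) (i j k : 'rV[int]_d) (l : int) (G : set conf).

Definition norm1 i : nat := (\sum_(a < d) `|i ord0 a|)%N.

Definition ball1 (r : nat) j : set 'rV[int]_d :=
  [set k | (norm1 (k - j) <= r)%N].

Definition translate k l x : conf := fun i => x (i + k) + l%:~R.

Definition cond_A (S : 'rV[int]_d -> conf -> R) : Prop :=
  exists2 r : nat, (0 < r)%N &
  exists s : forall j, {ptws ball1 r j -> R} -> R,
    forall j, C2 (s j) /\ forall x, S j x = s j (x \o set_val).

Definition cond_B (S : 'rV[int]_d -> conf -> R) : Prop :=
  forall j k l x, S j (translate k l x) = S (j + k) x.

Definition cond_C (S : 'rV[int]_d -> conf -> R) : Prop :=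
  (forall j i k x, i != k -> partial i (partial k (S j)) x <= 0) /\
  (forall i k x, norm1 (i - k) = 1%N -> partial i (partial k (S i)) x < 0).

(* Under [cond_A] only finitely many terms of the sum are nonzero. *)
Definition solution (V : R -> R) (S : 'rV[int]_d -> conf -> R) (eps : R) x
    : Prop :=
  forall i, derive1 V (x i) + eps * (\sum_(j \in [set: 'rV[int]_d])
                                   partial i (S j) x) = 0.

Definition conf_lt x y : Prop := x <> y /\ forall i, x i <= y i.

Definition ordered G : Prop :=
  forall x y, G x -> G y -> [\/ conf_lt x y, x = y | conf_lt y x].

Definition translation_invariant G : Prop := forall k l x, G x -> G (translate k l x).

Definition minimal G : Prop :=
  forall A : set conf, A !=set0 -> A `<=` G -> closed A -> translation_invariant A ->
    A = G.

(* Not required to be compact. [zero_dimensional C] says that any two distinct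
   points of the subspace [C] are separated by a partition of [C] into two
   closed sets; the library's [totally_disconnected] is the weaker condition on
   connected subsets. *)
Definition Cantor_set (C : set conf) : Prop :=
  perfect_set C /\ zero_dimensional C.

Definition lamination G : Prop :=
  [/\ G !=set0, ordered G, translation_invariant G & closed G] /\
  minimal G /\ exists2 C : set conf, Cantor_set C & homeomorphic G C.

Definition dotp (omega : 'rV[R]_d) i : R :=
  \sum_(a < d) omega ord0 a * (i ord0 a)%:~R.

Definition irrational_vector (omega : 'rV[R]_d) : Prop :=
  ~ exists q : 'rV[rat]_d, omega = map_mx ratr q.

Definition rotation_vector (omega : 'rV[R]_d) G : Prop :=
  forall x i, G x -> x (i *+ n) / n%:R @[n --> \oo] --> dotp omega i.

(* The two hull functions agree almost everywhere and define the same measure;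
   only the lower one is used. *)
Definition lower_hull (omega : 'rV[R]_d) x (s : R) : R :=
  get [set y : R | forall (k : nat -> 'rV[int]_d) (l : nat -> int),
         (forall n, dotp omega (k n) + (l n)%:~R < s) ->
         dotp omega (k n) + (l n)%:~R @[n --> \oo] --> s ->
         x (k n) + (l n)%:~R @[n --> \oo] --> y].

End Configurations.

Section Circle.
Variable R : realType.

Definition congruent1 : rel R := fun x y => x - y \is a Num.int.

Lemma congruent1_refl : reflexive congruent1.
Proof. by move=> x; rewrite /congruent1 subrr rpred0. Qed.

Lemma congruent1_sym : symmetric congruent1.
Proof. by move=> x y; rewrite /congruent1 -opprB rpredN. Qed.

Lemma congruent1_trans : transitive congruent1.
Proof.
by move=> y x z xy yz; rewrite /congruent1 -(subrKA y) rpredD.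
Qed.

Canonical congruent1_equiv :=
  EquivRel congruent1 congruent1_refl congruent1_sym congruent1_trans.

Definition circle : Type := quotient_topology {eq_quot congruent1_equiv}%qT.

HB.instance Definition _ := PointedTopological.on circle.

Definition to_circle (x : R) : circle := (\pi_circle x)%qT.

Definition borel_circle : Type := g_sigma_algebraType (@open circle).

HB.instance Definition _ := Measurable.on borel_circle.

(* On the compact metrizable space [circle] every Borel probability measure
   is a Radon measure. *)
Definition circle_measure : Type := probability borel_circle R.

HB.instance Definition _ := Choice.on circle_measure.

Definition integrate (mu : circle_measure)
    : {ptws continuousType circle R -> R} :=
  fun f => \int[mu]_t f t.

Definition vague_measures : Type := initial_topology integrate.

HB.instance Definition _ := Topological.on vague_measures.

End Circle.

Section Laminations.
Context {R : realType} {d : nat}.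
Variable omega : 'rV[R]_d.

Definition is_lamination_measure (G : set (config R d))
    (mu : circle_measure R) : Prop :=
  forall x, G x -> forall f : continuousType (circle R) R,
    \int[mu]_t f t =
    \int[lebesgue_measure]_(s in `[0, 1]) f (to_circle (lower_hull omega x s)).

(* Exists and is unique when [G] is a lamination of rotation vector [omega];
   the Dirac mass is a junk value. *)
Definition lamination_measure (G : set (config R d)) : vague_measures R :=
  xget (dirac (point : borel_circle R) : circle_measure R)
    (is_lamination_measure G).

Definition solution_laminations (V : R -> R)
    (S : 'rV[int]_d -> config R d -> R) (eps : R) : set (set (config R d)) :=
  [set G | [/\ lamination G, rotation_vector omega G &
               G `<=` solution V S eps]].

Definition lamination_space (V : R -> R)
    (S : 'rV[int]_d -> config R d -> R) (eps : R) : topologicalType :=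
  initial_topology (fun G : solution_laminations V S eps =>
    lamination_measure (set_val G)).

End Laminations.

Definition simplex (R : realType) (N : nat) : set 'rV[R]_N :=
  [set p : 'rV[R]_N | \sum_(a < N) p ord0 a = 1 /\ forall a, 0 <= p ord0 a].
Arguments simplex : clear implicits.

(* Main.v *)
Require Import Defs.
From mathcomp Require Import all_boot all_order all_algebra.
From mathcomp Require Import all_classical all_reals all_analysis.
From mathcomp Require Import measurable_realfun ring lra zify.
Import Order.TTheory GRing.Theory Num.Theory.
Import numFieldNormedType.Exports.

Local Open Scope classical_set_scope.
Local Open Scope ring_scope.
Set Implicit Arguments.
Unset Strict Implicit.
Unset Printing Implicit Defensive.

(** For small [eps] the equation is uncoupled up to a small perturbation, and a
    solution in a lamination is described by the sequence of minima of [V]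
    near which its coordinates lie. Such a sequence is a monotone step function
    of the phase [s + omega . k], so up to a translation of the phase it is
    determined by the proportions of the phases spent near each of the [N]
    minima. These proportions are the point of the simplex.

    Hull functions. Write a nondecreasing left-continuous [u] with
    [u (s + 1) = u s + 1] as a family of configurations
    [hull_conf u s k = u (s + omega . k)]. The closure of this family is ordered,
    invariant and minimal, all its elements have the lower hull function [u] up to
    translation ([lower_hull_at_phase]), and conversely every lamination of
    rotation vector [omega] is of this form ([ordered_minimal_hull_set]). The
    integrals against the measure of the lamination are therefore integrals of
    [f (u s)] over a period ([integrate_lamination_measure]).

    Solutions near minima. Off the diagonal the derivatives of the force are
    nonpositive, so a short gradient step is monotone; started at the lower edge
    of a narrow tube around a sequence of minima it increases to a solution in that
    tube, and the convexity of [V] near its minima makes this solution unique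
    ([coded_unique]) and exponentially insensitive to distant minima
    ([solution_decay]).

    Laminations avoid maxima. The equation makes the slope of [V] small at every
    coordinate of a solution, which is therefore near a minimum or near a maximum. Near a maximum the
    linearised equation has only nonpositive coefficients, while in a lamination,
    being perfect and ordered, every solution is a limit of solutions comparable to
    it; so the maxima are excluded ([solution_near_lattice]). Here the
    perfectness in the definition of a lamination is used.

    The homeomorphism. For [p] in the simplex [step_hull p] is the inverse of the
    distribution function of the combination with weights [p] of the point masses at the
    minima, and [coded_hull p] is the hull function of the corresponding solutions.
    Its hull set is a lamination. The inverse map integrates bump functions
    around the minima: [hull_function_weights] says that a step function with
    values at the minima is recovered from its proportions. The inverse is
    continuous for the vague topology because the bumps are continuous. In the
    other direction, if the weights converge then the step functions eventually
    agree on any finite set of sites, except at countably many phases, so the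
    hull functions converge almost everywhere and the integrals converge by dominated
    convergence ([integral_hull_cvg]). *)

(** * Rotation numbers, pointwise topology and order *)

Section DotProduct.
Context {R : realType} {d : nat}.
Variable omega : 'rV[R]_d.
Local Notation dotp := (dotp omega).

Lemma dotp0 : dotp 0 = 0.
Proof. by rewrite /Defs.dotp big1// => a _; rewrite mxE mulr0. Qed.

Lemma dotpD i k : dotp (i + k) = dotp i + dotp k.
Proof.
rewrite /Defs.dotp -big_split; apply: eq_bigr => a _.
by rewrite mxE intrD mulrDr.
Qed.

Lemma dotpN i : dotp (- i) = - dotp i.
Proof. by apply/eqP; rewrite -addr_eq0 -dotpD addNr dotp0. Qed.

Lemma dotpB i k : dotp (i - k) = dotp i - dotp k.
Proof. by rewrite dotpD dotpN. Qed.

Lemma dotpMn i n : dotp (i *+ n) = dotp i *+ n.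
Proof.
elim: n => [|n IHn]; first by rewrite !mulr0n dotp0.
by rewrite !mulrS dotpD IHn.
Qed.

Lemma dotpMz i (n : int) : dotp (i *~ n) = dotp i * n%:~R.
Proof.
case: n => n; first by rewrite -pmulrn dotpMn mulr_natr.
by rewrite NegzE mulrNz dotpN intrN mulrN -pmulrn dotpMn mulr_natr.
Qed.

Lemma dotp_delta a : dotp (delta_mx 0 a) = omega 0 a.
Proof.
rewrite /Defs.dotp (bigD1 a)//= big1 ?addr0; last first.
  by move=> b ba; rewrite mxE eqxx (negbTE ba) mulr0.
by rewrite mxE !eqxx mulr1.
Qed.

Hypothesis omega_irr : irrational_vector omega.

(** The values of [omega . k + l] form a subgroup of the line. If it had a
    least positive element [g], every value would be an integer multiple of
    [g], including [1] and the coordinates of [omega], which would then be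
    rational; so the positive values have infimum [0]. *)
Lemma dotp_dense a b : a < b -> exists k l, a < dotp k + l%:~R < b.
Proof.
move=> ab.
pose P := [set h : R | 0 < h /\ exists k l, h = dotp k + l%:~R].
have P1 : P 1 by split => //; exists 0, 1; rewrite dotp0 add0r.
have lbP : has_lbound P by exists 0 => h [/ltW].
have infP : has_inf P by split => //; exists 1.
have g_ge0 : 0 <= inf P by apply: lb_le_inf; [exists 1|move=> h [/ltW]].
set g := inf P in g_ge0.
have [g_gt0|g_le0] := ltP 0 g; last first.
  have g0 : g = 0 by apply/eqP; rewrite eq_le g_le0.
  have [|h [h0 [k [l hkl]]]] := @inf_adherent R P (b - a) _ infP.
    by rewrite subr_gt0.
  rewrite -/g g0 add0r => hab.
  pose n := Num.floor (a / h) + 1.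
  have n_gt : a < h * n%:~R.
    by rewrite mulrC -ltr_pdivrMr// floorD1_gt.
  have n_le : h * n%:~R <= a + h.
    rewrite intrD mulrDr mulr1 lerD2r mulrC -ler_pdivlMr//; exact: floor_le.
  exists (k *~ n), (l * n); rewrite dotpMz intrM -mulrDl -hkl n_gt /=.
  by apply: le_lt_trans n_le _; rewrite addrC -ltrBrDr.
have Pg : P g.
  have [h Ph h2g] := inf_adherent g_gt0 infP; rewrite -/g in h2g.
  have := ge_inf lbP Ph; rewrite -/g le_eqVlt => /orP[/eqP-> //|gh].
  have hg : 0 < h - g by rewrite subr_gt0.
  have [h' Ph' h'h] := inf_adherent hg infP; rewrite -/g in h'h.
  have h'_ge : g <= h' := ge_inf lbP Ph'.
  have Phh' : P (h - h').
    case: Ph Ph' => h0 [k [l hkl]] [h'0 [k' [l' h'kl]]].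
    split; first lra.
    by exists (k - k'), (l - l'); rewrite dotpB intrB hkl h'kl; lra.
  have := ge_inf lbP Phh'; rewrite -/g; lra.
have multiple k l : exists n : int, dotp k + l%:~R = g * n%:~R.
  pose v := dotp k + l%:~R; pose n := Num.floor (v / g).
  exists n; apply/eqP; rewrite -subr_eq0.
  have r_ge0 : 0 <= v - g * n%:~R.
    by rewrite subr_ge0 mulrC -ler_pdivlMr// floor_le.
  have r_lt : v - g * n%:~R < g.
    rewrite ltrBlDr -[X in X + _]mulr1 -mulrDr addrC mulrC -ltr_pdivrMr//.
    by have := floorD1_gt (v / g); rewrite intrD.
  move: r_ge0; rewrite -/v le_eqVlt eq_sym => /orP[//|r_gt0].
  have Pr : P (v - g * n%:~R).
    split => //; have [_ [k' [l' gkl]]] := Pg.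
    exists (k - k' *~ n), (l - l' * n).
    by rewrite dotpB dotpMz intrB intrM /v gkl; ring.
  have := ge_inf lbP Pr; rewrite -/g; lra.
have [n1 n1E] := multiple 0 1; rewrite dotp0 add0r in n1E.
have n1_neq0 : n1%:~R != 0 :> R.
  by apply/eqP => n10; move: n1E; rewrite n10 mulr0; lra.
case: omega_irr.
have omegaE e : {n : int | omega 0 e = n%:~R / n1%:~R}.
  apply: cid; have [n] := multiple (delta_mx 0 e) 0.
  rewrite dotp_delta addr0 => ->; exists n.
  by apply: (mulIf n1_neq0); rewrite divfK// mulrAC -n1E mul1r.
exists (\row_e ((sval (omegaE e))%:~R / n1%:~R)); apply/rowP => e.
by rewrite [RHS]mxE [in RHS]mxE fmorph_div/= !ratr_int; exact: svalP (omegaE e).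
Qed.

End DotProduct.

Section PointwiseTopology.
Context {R : realType}.

Lemma ptws_proj_continuous {I : eqType} (i : I) :
  continuous (fun x : {ptws I -> R} => x i).
Proof. exact: (@proj_continuous I (fun=> R) i). Qed.

Lemma ptws_cvgP {I : eqType} {T : Type} (F : set_system T) (FF : Filter F)
    (g : T -> {ptws I -> R}) (x : {ptws I -> R}) :
  g @ F --> x <-> forall i, (fun t => g t i) @ F --> x i.
Proof.
split=> [gx i|gx].
  exact: (cvg_comp _ _ gx (@ptws_proj_continuous I i x)).
apply/cvg_sup => i U [V [[A oA <-] Ax] AU].
have : \forall t \near F, A (g t i) by apply: (gx i); exact: open_nbhs_nbhs.
by apply: filterS => t; exact: AU.
Qed.

Lemma ptws_continuousP {I : eqType} {T : topologicalType}
    (g : T -> {ptws I -> R}) :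
  continuous g <-> forall i, continuous (fun t => g t i).
Proof.
split=> [cg i t|cg t]; first by move: (cg t) => /ptws_cvgP; exact.
by apply/ptws_cvgP => i; exact: cg.
Qed.

End PointwiseTopology.

Section ConfigurationOrder.
Context {R : realType} {d : nat}.
Local Notation conf := (config R d).
Implicit Types (x y : conf) (A : set conf).

Definition conf_le x y : Prop := forall i, x i <= y i.
Definition comparable x y : Prop := conf_le x y \/ conf_le y x.

Lemma conf_le_trans y x z : conf_le x y -> conf_le y z -> conf_le x z.
Proof. by move=> xy yz i; exact: le_trans (xy i) (yz i). Qed.

Lemma orderedP A : ordered A <-> forall x y, A x -> A y -> comparable x y.
Proof.
split=> [oA x y Ax Ay|cA x y Ax Ay].
  by case: (oA _ _ Ax Ay) => [[_]|->|[_]]; [left|left => i|right].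
have [->|xy] := EM (x = y); first exact: Or32.
case: (cA _ _ Ax Ay) => h; first by apply: Or31; split.
by apply: Or33; split=> // yx; exact: xy.
Qed.

Lemma closed_conf_ge y : closed [set x : conf | conf_le y x].
Proof.
rewrite [X in closed X](_ : _ =
    \bigcap_i ((fun x : conf => x i) @^-1` [set t | y i <= t])).
  apply: closed_bigI => i _; apply: preimage_closed; last exact: closed_ge.
  by move=> x _; exact: ptws_proj_continuous.
by apply/seteqP; split=> [x h i _|x h i]; exact: h.
Qed.

Lemma closed_conf_le y : closed [set x : conf | conf_le x y].
Proof.
rewrite [X in closed X](_ : _ =
    \bigcap_i ((fun x : conf => x i) @^-1` [set t | t <= y i])).
  apply: closed_bigI => i _; apply: preimage_closed; last exact: closed_le.
  by move=> x _; exact: ptws_proj_continuous.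
by apply/seteqP; split=> [x h i _|x h i]; exact: h.
Qed.

Lemma closure_comparable A : (forall x y, A x -> A y -> comparable x y) ->
  forall x y, closure A x -> closure A y -> comparable x y.
Proof.
move=> cA.
have closed_cmp y : closed [set x : conf | comparable x y].
  rewrite [X in closed X](_ : _ =
    [set x | conf_le x y] `|` [set x | conf_le y x])//.
  by apply: closedU; [exact: closed_conf_le|exact: closed_conf_ge].
have cl_cmp y x : (forall z, A z -> comparable z y) -> closure A x ->
    comparable x y.
  move=> Ay; rewrite closureE => /(_ [set z | comparable z y]); apply.
  by split; [exact: closed_cmp|exact: Ay].
move=> x y clx cly; apply: (cl_cmp y x) => // z Az.
have [h|h] : comparable y z by apply: (cl_cmp z y) => // t At; exact: cA.
- by right.
- by left.
Qed.

Lemma translate_continuous k l : continuous (translate k l : conf -> conf).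
Proof.
apply/ptws_continuousP => i x.
apply: (@continuous_comp _ _ _ (fun y : conf => y (i + k)) (fun t => t + l%:~R)).
  exact: ptws_proj_continuous.
by apply: cvgD; [exact: cvg_id|exact: cvg_cst].
Qed.

Lemma closure_translation_invariant A :
  translation_invariant A -> translation_invariant (closure A).
Proof.
move=> tA k l x clx U /(translate_continuous (x := x)) Ux.
by have [y [Ay Uy]] := clx _ Ux; exists (translate k l y); split=> //; exact: tA.
Qed.

End ConfigurationOrder.

(** * Hull functions and minimal ordered sets *)

Section HullFunctions.
Context {R : realType} {d : nat}.
Variable omega : 'rV[R]_d.
Hypothesis omega_irr : irrational_vector omega.
Local Notation conf := (config R d).
Local Notation dotp := (dotp omega).
Implicit Types (u : R -> R) (x y : conf) (s t e : R) (k : 'rV[int]_d) (l : int).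

(** Left-continuity selects one of the two hull functions, so that equality of
    functions, and not only equality almost everywhere, is available. *)
Definition hull_function u : Prop :=
  [/\ {homo u : s t / s <= t}, forall s, u (s + 1) = u s + 1 &
      forall s e, 0 < e -> exists2 t, t < s & u s - e < u t].

Lemma hull_shift u s l : hull_function u -> u (s + l%:~R) = u s + l%:~R.
Proof.
case=> _ u1 _; have nat_shift n r : u (r + n%:R) = u r + n%:R.
  by elim: n r => [|n IHn] r; rewrite ?addr0// -addn1 natrD !addrA u1 IHn.
case: l => n; first exact: nat_shift.
by apply: (addIr n.+1%:R); rewrite -nat_shift NegzE mulrNz !subrK.
Qed.

Lemma hull_bound u s : hull_function u -> `|u s - u 0 - s| <= 1.
Proof.
move=> hu; have [u_homo _ _] := hu.
have /andP[ns sn] := floor_itv s; set n := Num.floor s in ns sn.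
have u_ge := u_homo _ _ ns; have u_le := u_homo _ _ (ltW sn).
move: u_ge u_le sn; rewrite -[n%:~R]add0r -[(n + 1)%:~R]add0r !hull_shift//.
by rewrite intrD ler_norml => *; apply/andP; split; lra.
Qed.

Definition hull_conf u t : conf := fun k => u (t + dotp k).

Lemma hull_conf_le u s t : hull_function u -> s <= t ->
  conf_le (hull_conf u s) (hull_conf u t).
Proof. by case=> u_homo _ _ st k; apply: u_homo; rewrite lerD2r. Qed.

Lemma translate_hull_conf u t k l : hull_function u ->
  translate k l (hull_conf u t) = hull_conf u (t + (dotp k + l%:~R)).
Proof.
move=> hu; apply/funext => i; rewrite /translate /hull_conf -hull_shift//.
by congr u; rewrite dotpD; ring.
Qed.

Definition hull_set u : set conf := closure (range (hull_conf u)).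

Lemma hull_conf_hull_set u t : hull_set u (hull_conf u t).
Proof. by apply: subset_closure; exists t. Qed.

Lemma hull_set_comparable u x y : hull_function u ->
  hull_set u x -> hull_set u y -> comparable x y.
Proof.
move=> hu; apply: closure_comparable => _ _ [s _ <-] [t _ <-].
by have [st|/ltW ts] := leP s t; [left|right]; exact: hull_conf_le.
Qed.

Lemma hull_set_invariant u : hull_function u -> translation_invariant (hull_set u).
Proof.
move=> hu; apply: closure_translation_invariant => k l _ [t _ <-].
by rewrite translate_hull_conf//; exists (t + (dotp k + l%:~R)).
Qed.

(** When [u] jumps at some [t + omega . k] the hull set can contain both one-sided
    limits of [hull_conf u] at [t]. These bounds hold for either, and they
    already determine the hull function and the rotation vector of [x]. *)
Definition at_phase u t x : Prop := forall e, 0 < e ->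
  conf_le (hull_conf u (t - e)) x /\ conf_le x (hull_conf u (t + e)).

Lemma hull_set_at_phase u x : hull_function u -> hull_set u x ->
  exists t, at_phase u t x.
Proof.
move=> hu ux; have [u_homo _ _] := hu.
pose E := [set t | conf_le (hull_conf u t) x].
have val0 t : hull_conf u t 0 = u t by rewrite /hull_conf dotp0 addr0.
have ux_bound t : `|u t - u 0 - t| <= 1 by exact: hull_bound.
have cmp t : comparable (hull_conf u t) x.
  exact: (hull_set_comparable hu (@hull_conf_hull_set u t) ux).
have E_lt t : t < x 0 - u 0 - 1 -> E t.
  move=> t_lt; case: (cmp t) => // /(_ 0); rewrite val0.
  by have := ux_bound t; rewrite ler_norml => /andP[_ h] ?; exfalso; lra.
have supE : has_sup E.
  split; first by exists (x 0 - u 0 - 2); apply: E_lt; lra.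
  exists (x 0 - u 0 + 1) => t /(_ 0); rewrite val0.
  by have := ux_bound t; rewrite ler_norml => /andP[h _] ?; lra.
exists (sup E) => e e0; split.
  have [t Et tE] := sup_adherent e0 supE.
  by apply: conf_le_trans Et; apply: hull_conf_le => //; exact: ltW.
case: (cmp (sup E + e)) => // /(sup_upper_bound supE); lra.
Qed.

Lemma at_phase_bound u t x k : hull_function u -> at_phase u t x ->
  `|x k - dotp k - (t + u 0)| <= 1.
Proof.
move=> hu tx; rewrite ler_norml.
suff h e : 0 < e -> - 1 - e <= x k - dotp k - (t + u 0) <= 1 + e.
  by apply/andP; split; apply/ler_addgt0Pl => e /h /andP[]; lra.
move=> e0; have [/(_ k) + /(_ k)] := tx e e0; rewrite /hull_conf => h1 h2.
have := hull_bound (t - e + dotp k) hu; have := hull_bound (t + e + dotp k) hu.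
by rewrite !ler_norml => /andP[_ ?] /andP[? _]; apply/andP; split; lra.
Qed.

Lemma bounded_rotation_cvg (L : R) x i :
  (forall k, `|x k - dotp k| <= L) -> x (i *+ n) / n%:R @[n --> \oo] --> dotp i.
Proof.
move=> xL; apply/cvgrPdist_le => e e0.
near=> n.
have n0 : 0 < n%:R :> R by rewrite ltr0n; near: n; exists 1%N.
have -> : dotp i - x (i *+ n) / n%:R = - (x (i *+ n) - dotp (i *+ n)) / n%:R.
  by rewrite dotpMn -[dotp i *+ n]mulr_natr; field; rewrite gt_eqF.
rewrite normrM normrN normfV normr_nat ler_pdivrMr//.
apply: le_trans (xL _) _; rewrite -ler_pdivrMl//.
by near: n; exact: nbhs_infty_ger.
Unshelve. all: by end_near. Qed.

Lemma at_phase_rotation u t x i : hull_function u -> at_phase u t x ->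
  x (i *+ n) / n%:R @[n --> \oo] --> dotp i.
Proof.
move=> hu tx; apply: (@bounded_rotation_cvg (1 + `|t + u 0|)) => k.
rewrite -(subrK (t + u 0) (_ - _)); apply: le_trans (ler_normD _ _) _.
by rewrite lerD2r; exact: at_phase_bound hu tx.
Qed.

Section LimitsFromBelow.
Variables (k : nat -> 'rV[int]_d) (l : nat -> int) (s : R).
Hypothesis h_lt : forall n, dotp (k n) + (l n)%:~R < s.
Hypothesis h_cvg : dotp (k n) + (l n)%:~R @[n --> \oo] --> s.

Lemma at_phase_cvg u t x : hull_function u -> at_phase u t x ->
  x (k n) + (l n)%:~R @[n --> \oo] --> u (t + s).
Proof.
move=> hu tx; have [u_homo _ u_left] := hu.
apply/cvgrPdist_le => e e0.
have [r r_lt ur] := u_left (t + s) e e0.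
near=> n.
have hr : r - t < dotp (k n) + (l n)%:~R.
  by near: n; apply: (cvgr_gt s h_cvg); lra.
have hs := h_lt n; set h := dotp (k n) + (l n)%:~R in hr hs.
have phase_shift q : hull_conf u q (k n) + (l n)%:~R = u (q + h).
  by rewrite /hull_conf -hull_shift// /h addrA.
have [low _] := tx (h - (r - t)) ltac:(lra).
have [_ up] := tx (s - h) ltac:(lra).
have {}low : u r <= x (k n) + (l n)%:~R.
  by have := low (k n); rewrite -(lerD2r (l n)%:~R) phase_shift; congr (u _ <= _); lra.
have {}up : x (k n) + (l n)%:~R <= u (t + s).
  by have := up (k n); rewrite -(lerD2r (l n)%:~R) phase_shift; congr (_ <= u _); lra.
rewrite ger0_norm ?subr_ge0//; lra.
Unshelve. all: by end_near. Qed.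

End LimitsFromBelow.

Lemma dotp_seq_below s : exists (k : nat -> 'rV[int]_d) (l : nat -> int),
  (forall n, dotp (k n) + (l n)%:~R < s) /\
  dotp (k n) + (l n)%:~R @[n --> \oo] --> s.
Proof.
have step n : {kl : 'rV[int]_d * int |
    s - n.+1%:R^-1 < dotp kl.1 + kl.2%:~R < s}.
  apply: cid; have [|k [l kl]] := dotp_dense omega_irr (_ : s - n.+1%:R^-1 < s).
    by rewrite ltrBlDr ltrDl invr_gt0.
  by exists (k, l).
exists (fun n => (sval (step n)).1), (fun n => (sval (step n)).2); split.
  by move=> n; have /andP[] := svalP (step n).
apply: (@squeeze_cvgr _ _ _ _ (fun n => s - n.+1%:R^-1) (fun=> s)).
- by apply: nearW => n; have /andP[h1 h2] := svalP (step n); rewrite !ltW.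
- rewrite -[X in _ --> X]subr0; apply: cvgB; first exact: cvg_cst.
  exact: cvg_harmonic.
- exact: cvg_cst.
Qed.

Lemma translate_cvg_hull_conf u t x (k : nat -> 'rV[int]_d) (l : nat -> int) s : hull_function u -> at_phase u t x ->
  (forall n, dotp (k n) + (l n)%:~R < s) ->
  dotp (k n) + (l n)%:~R @[n --> \oo] --> s ->
  translate (k n) (l n) x @[n --> \oo] --> hull_conf u (t + s).
Proof.
move=> hu tx h_lt h_cvg; apply/ptws_cvgP => i.
rewrite /translate /hull_conf -addrA [s + _]addrC.
have := @at_phase_cvg (fun n => i + k n) l (dotp i + s) _ _ u t x hu tx; apply.
  by move=> n; rewrite dotpD -addrA ltrD2l.
under eq_fun do rewrite dotpD -addrA.
by apply: cvgD; [exact: cvg_cst|exact: h_cvg].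
Qed.

Lemma lower_hull_at_phase u t x s : hull_function u -> at_phase u t x ->
  lower_hull omega x s = u (t + s).
Proof.
move=> hu tx; rewrite /lower_hull; set P := [set y | _].
have Pu : P (u (t + s)) by move=> k l h_lt h_cvg; exact: at_phase_cvg.
have [k [l [h_lt h_cvg]]] := dotp_seq_below s.
have Pget : P (get P) by exact: getI Pu.
by have := cvg_unique _ (Pget k l h_lt h_cvg) (Pu k l h_lt h_cvg); apply.
Qed.

(** The orbit of any point of the hull set accumulates from below at every
    [hull_conf u t], and these configurations are dense. *)
Lemma hull_set_minimal u : hull_function u -> minimal (hull_set u).
Proof.
move=> hu A [x Ax] A_sub cA tA; apply/seteqP; split => //.
have [t tx] := hull_set_at_phase hu (A_sub _ Ax).
rewrite [X in _ `<=` X](closure_id A).1//; apply: closureS => _ [s _ <-].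
have [k [l [h_lt h_cvg]]] := dotp_seq_below (s - t).
rewrite -(subrK t s) addrC.
apply: (closed_cvg A cA _ _ (translate_cvg_hull_conf hu tx h_lt h_cvg)).
by apply: nearW => n; exact: tA.
Qed.

Section HullOfOrderedSet.
Variables (G : set conf) (x : conf).
Hypothesis G_ordered : ordered G.
Hypothesis G_invariant : translation_invariant G.
Hypothesis G_rotation : rotation_vector omega G.
Hypothesis Gx : G x.

(** If the translate with the smaller rotation were the larger one, iterating
    the resulting inequality would give [x] a drift of the wrong sign. *)
Lemma translates_increasing k l k' l' :
  dotp k + l%:~R < dotp k' + l'%:~R -> x k + l%:~R <= x k' + l'%:~R.
Proof.
move=> hh'.
have := (orderedP G).1 G_ordered _ _
  (G_invariant k l Gx) (G_invariant k' l' Gx).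
case=> [/(_ 0)|h]; first by rewrite /translate !add0r.
exfalso.
pose q := k - k'; pose e := l - l'.
have x_le i : x i <= x (i + q) + e%:~R.
  have := h (i - k'); rewrite /translate subrK /e intrB.
  by rewrite (_ : i - k' + k = i + q); [lra|rewrite /q addrAC addrA].
have x_iter n : x 0 <= x (q *+ n) + n%:R * e%:~R.
  elim: n => [|n IHn]; first by rewrite mulr0n mul0r addr0.
  have := x_le (q *+ n); rewrite mulrSr -natr1 mulrDl mul1r => ?.
  by lra.
have L_lt : dotp q + e%:~R < 0 by rewrite /q /e dotpB intrB; lra.
set c := - (dotp q + e%:~R) / 2.
have c0 : 0 < c by rewrite /c; lra.
have : \forall n \near \oo, False; last by move/filter_ex => [].
near=> n.
have n0 : 0 < n%:R :> R by rewrite ltr0n; near: n; exists 1%N.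
have h1 : x (q *+ n) / n%:R < dotp q + c.
  by near: n; apply: (cvgr_lt (dotp q) (G_rotation Gx)); lra.
have h2 : - x 0 / c < n%:R by near: n; exact: nbhs_infty_gtr.
have := x_iter n; move: h1 h2; rewrite !ltr_pdivrMr// /c => *.
nra.
Unshelve. all: by end_near. Qed.

Let values s := [set x kl.1 + kl.2%:~R |
  kl in [set kl : 'rV[int]_d * int | dotp kl.1 + kl.2%:~R < s]].

Definition hull_of s : R := sup (values s).

Lemma has_sup_values s : has_sup (values s).
Proof.
split.
  have [|k [l /andP[_ kl]]] := dotp_dense omega_irr (_ : s - 1 < s); first lra.
  by exists (x k + l%:~R); exists (k, l).
have [|k [l /andP[kl _]]] := dotp_dense omega_irr (_ : s < s + 1); first lra.
exists (x k + l%:~R) => _ [[k' l'] /= kl' <-].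
by apply: translates_increasing; lra.
Qed.

Lemma le_hull_of s k l : dotp k + l%:~R < s -> x k + l%:~R <= hull_of s.
Proof. by move=> kl; apply: (sup_upper_bound (has_sup_values s)); exists (k, l). Qed.

Lemma hull_of_le s c : (forall k l, dotp k + l%:~R < s -> x k + l%:~R <= c) ->
  hull_of s <= c.
Proof.
move=> xc; apply: ge_sup; first by have [] := has_sup_values s.
by move=> _ [[k l] /= kl <-]; exact: xc.
Qed.

Lemma hull_of_adherent s e : 0 < e ->
  exists k l, dotp k + l%:~R < s /\ hull_of s - e < x k + l%:~R.
Proof.
move=> e0; have [_ [[k l] /= kl <-] h] := sup_adherent e0 (has_sup_values s).
by exists k, l.
Qed.

Lemma hull_of_hull_function : hull_function hull_of.
Proof.
split.
- move=> s t st; apply: hull_of_le => k l kl.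
  by apply: le_hull_of; exact: lt_le_trans st.
- move=> s; apply/le_anti/andP; split.
    apply: hull_of_le => k l kl; rewrite -lerBlDr -addrA.
    rewrite -[l%:~R - 1](intrB _ l 1); apply: le_hull_of.
    by rewrite intrB; lra.
  rewrite -lerBrDr; apply: hull_of_le => k l kl; rewrite lerBrDr -addrA.
  rewrite -[l%:~R + 1](intrD _ l 1); apply: le_hull_of.
  by rewrite intrD; lra.
- move=> s e e0; have [k [l [kl h]]] := hull_of_adherent s e0.
  exists ((s + (dotp k + l%:~R)) / 2); first lra.
  by apply: lt_le_trans h _; apply: le_hull_of; lra.
Qed.

Lemma hull_conf_hull_of : closed G -> G (hull_conf hull_of 0).
Proof.
move=> cG; have [k [l [h_lt h_cvg]]] := dotp_seq_below 0.
apply: (closed_cvg (u_ := fun n => translate (k n) (l n) x) (F := \oo) G cG).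
  by apply: nearW => n; exact: G_invariant.
apply/ptws_cvgP => i; rewrite /hull_conf add0r /translate.
apply/cvgrPdist_le => e e0.
have [k' [l' [kl' h]]] := hull_of_adherent (dotp i) e0.
near=> n.
have low : x k' + l'%:~R <= x (i + k n) + (l n)%:~R.
  apply: translates_increasing; rewrite dotpD -addrA -ltrBlDl.
  by near: n; apply: (cvgr_gt 0 h_cvg); lra.
have up : x (i + k n) + (l n)%:~R <= hull_of (dotp i).
  by apply: le_hull_of; rewrite dotpD -addrA gtrDl.
rewrite ger0_norm ?subr_ge0//; lra.
Unshelve. all: by end_near. Qed.

(** Both sets are minimal and they share the configuration
    [hull_conf (hull_of omega x) 0]. *)
Lemma ordered_minimal_hull_set : closed G -> minimal G -> G = hull_set hull_of.
Proof.
move=> cG mG; have hu := hull_of_hull_function.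
have GU0 : (G `&` hull_set hull_of) !=set0.
  exists (hull_conf hull_of 0); split; first exact: hull_conf_hull_of.
  exact: hull_conf_hull_set.
have closedGU : closed (G `&` hull_set hull_of).
  by apply: closedI => //; exact: closed_closure.
have invGU : translation_invariant (G `&` hull_set hull_of).
  by move=> k l y [Gy Uy]; split; [exact: G_invariant|exact: hull_set_invariant].
rewrite -[LHS](mG _ GU0 _ closedGU invGU)//.
exact: (hull_set_minimal hu GU0 _ closedGU invGU).
Qed.

End HullOfOrderedSet.

End HullFunctions.

(** * The measure of a lamination *)

Section CircleFunctions.
Context {R : realType}.
Implicit Types (f : continuousType (circle R) R) (r s t : R).

Lemma to_circle_congruent r s : r - s \is a Num.int -> to_circle r = to_circle s.
Proof. by move=> rs; apply/eqquotP. Qed.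

Lemma to_circle_shift r (l : int) : to_circle (r + l%:~R) = to_circle r.
Proof. by apply: to_circle_congruent; rewrite addrAC subrr add0r intr_int. Qed.

Lemma to_circle_continuous : continuous (@to_circle R).
Proof. exact: pi_continuous. Qed.

Lemma circle_fun_continuous f : continuous (f \o @to_circle R).
Proof.
move=> r; apply: continuous_comp; first exact: to_circle_continuous.
exact: (@cts_fun _ _ f).
Qed.

Lemma circle_fun_bounded f : exists C : R, forall t : circle R, `|f t| <= C.
Proof.
pose g : R -> R := fun r => `|f (to_circle r)|.
have gc : continuous g.
  move=> r; apply: (@continuous_comp _ _ _ (f \o @to_circle R) Num.norm).
    exact: circle_fun_continuous.
  exact: norm_continuous.
have [|c _ hc] := @EVT_max R g 0 1 ler01; first exact: continuous_subspaceT.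
exists (g c) => t; rewrite -[t]reprK.
set r : R := repr t; have -> : \pi_(circle R)%qT r = to_circle r by [].
rewrite -(subrK (Num.floor r)%:~R r) to_circle_shift; apply: hc.
rewrite in_itv/= subr_ge0 floor_le lerBlDl.
by have := ltW (floorD1_gt r); rewrite intrD.
Qed.

Lemma measurable_to_circle :
  measurable_fun [set: measurableTypeR R] (@to_circle R : R -> borel_circle R).
Proof.
apply: (@measurability _ _ (measurableTypeR R) (borel_circle R) setT (@to_circle R) (@open (circle R))) => //.
move=> _ [B oB <-]; rewrite setTI; apply: open_measurable.
by move/continuousP: to_circle_continuous; exact.
Qed.

Lemma measurable_circle_fun f :
  measurable_fun setT (f : borel_circle R -> R).
Proof.
apply: (@measurability _ _ _ _ setT _ (@RGenOInfty.G R)).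
  exact: RGenOInfty.measurableE.
move=> _ [_ [x ->] <-]; rewrite setTI; apply: sub_sigma_algebra.
by have /continuousP := @cts_fun _ _ f; apply; exact: interval_open.
Qed.

End CircleFunctions.

Section PeriodIntegrals.
Context {R : realType}.
Implicit Types (h : R -> R) (s t a b C : R).
Local Notation mu := (@lebesgue_measure R).

Lemma bounded_itv_integrable h C (i : interval R) : measurable_fun [set: measurableTypeR R] h ->
  (forall s, `|h s| <= C) -> (mu [set` i] < +oo)%E ->
  mu.-integrable [set` i] (EFin \o h).
Proof.
move=> mh hC muoo; apply: measurable_bounded_integrable => //.
  exact: measurable_funTS.
exists C; split; first exact: num_real.
by move=> M CM s _; apply: le_trans (hC s) (ltW CM).
Qed.

Lemma segment_finite a b : (mu `[a, b]%classic < +oo)%E.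
Proof. by rewrite lebesgue_measure_itv/=; case: ifP => _; rewrite ?EFinN ltry. Qed.

Lemma unit_integral_cst C : \int[mu]_(s in `[0, 1]) C = C.
Proof.
by rewrite Rintegral_cst//= lebesgue_measure_itv/= lte_fin ltr01 sube0 mulr1.
Qed.

Lemma lebesgue_measure_shift t (A : set R) : measurable A ->
  pushforward mu ((fun s => t + s) : R -> measurableTypeR R) A = mu A.
Proof.
have mt : measurable_fun [set: measurableTypeR R] ((fun s => t + s) : R -> measurableTypeR R).
  by apply: continuous_measurable_fun => s; apply: cvgD; [exact: cvg_cst|exact: cvg_id].
move=> mA; pose shift : R -> measurableTypeR R := fun s => t + s.
apply/esym; apply: (@lebesgue_measure_unique R (pushforward mu shift)) => //.
move=> _ [[a b]] _ <- /=.
transitivity (mu [set` `]a - t, b - t]]); last first.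
  congr (mu _); apply/seteqP; split=> s /=; rewrite /shift !in_itv/= => /andP[? ?];
  by apply/andP; split; lra.
rewrite !lebesgue_measure_itv/= !lte_fin ltrD2r.
by case: ifP => // _; rewrite -!EFinD; congr EFin; ring.
Qed.

Lemma Rintegral_shift h C t a b : measurable_fun [set: measurableTypeR R] h ->
  (forall s, `|h s| <= C) ->
  \int[mu]_(s in `[a, b]) h (t + s) = \int[mu]_(s in `[t + a, t + b]) h s.
Proof.
move=> mh hC; rewrite /Rintegral; congr fine.
have mt : measurable_fun [set: measurableTypeR R] ((fun s => t + s) : R -> measurableTypeR R).
  by apply: continuous_measurable_fun => s; apply: cvgD; [exact: cvg_cst|exact: cvg_id].
have preE : (fun s => t + s) @^-1` [set` `[t + a, t + b]] = [set` `[a, b]].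
  by apply/seteqP; split=> s /=; rewrite !in_itv/= => /andP[? ?]; apply/andP; split; lra.
pose shift : R -> measurableTypeR R := fun s => t + s.
transitivity (\int[pushforward mu shift]_(s in [set` `[(t + a)%R, (t + b)%R]]) (h s)%:E)%E.
  rewrite integral_pushforward//= ?preE//.
  - exact/measurable_EFinP.
  - apply: (@bounded_itv_integrable (h \o (fun s => t + s)) C) => //.
    + exact: measurableT_comp.
    + by move=> s; exact: hC.
    + exact: segment_finite.
apply: eq_measure_integral => A mA _; exact: lebesgue_measure_shift.
Qed.

(** The interval of length one starting at [t] is cut at the integer it
    contains and the second piece is translated back by one. *)
Lemma Rintegral_periodic h C t : measurable_fun [set: measurableTypeR R] h ->
  (forall s, `|h s| <= C) -> periodic h 1 ->
  \int[mu]_(s in `[0, 1]) h (t + s) = \int[mu]_(s in `[0, 1]) h s.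
Proof.
move=> mh hC h1.
have intble (i : interval R) : (mu [set` i] < +oo)%E ->
    mu.-integrable [set` i] (EFin \o h) by exact: bounded_itv_integrable mh hC.
have hn s (n : int) : h (s + n%:~R) = h s.
  have nat_shift m r : h (r + m%:R) = h r.
    by elim: m r => [|m IHm] r; rewrite ?addr0// -addn1 natrD addrA h1.
  case: n => m; first exact: nat_shift.
  by rewrite -(nat_shift m.+1) NegzE mulrNz subrK.
pose n := Num.floor t; pose a := t - n%:~R.
have a0 : 0 <= a by rewrite subr_ge0 floor_le.
have a1 : a <= 1 by rewrite lerBlDl -(intrD _ n 1); exact/ltW/floorD1_gt.
transitivity (\int[mu]_(s in `[0, 1]) h (a + s)).
  by apply: eq_Rintegral => s _; rewrite -[RHS](hn _ n) /a; congr h; ring.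
rewrite (Rintegral_shift a 0 1 mh hC) addr0.
have split_at x y z : x <= y -> y <= z -> \int[mu]_(s in `[x, z]) h s =
    \int[mu]_(s in `[x, y]) h s + \int[mu]_(s in `[y, z]) h s.
  move=> xy yz; rewrite -(@Rintegral_itv_obnd_cbnd _ y); last first.
    by apply: intble; rewrite lebesgue_measure_itv/=; case: ifP => _; rewrite ?EFinN ltry.
  rewrite -(@Rintegral_itvB _ h (BLeft x) (BRight z) y) ?bnd_simp//.
    by rewrite addrC subrK.
  by apply: intble; exact: segment_finite.
rewrite (split_at a 1 (a + 1)) ?lerDr//.
rewrite (split_at 0 a 1)// addrC; congr (_ + _).
rewrite -[X in `[X, _]]addr0 [a + 1]addrC -(Rintegral_shift 1 0 a mh hC).
by apply: eq_Rintegral => s _; rewrite addrC h1.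
Qed.

End PeriodIntegrals.

Section LaminationMeasure.
Context {R : realType} {d : nat}.
Variable omega : 'rV[R]_d.
Hypothesis omega_irr : irrational_vector omega.
Local Notation mu := (@lebesgue_measure R).
Implicit Types (u : R -> R) (f : continuousType (circle R) R).

Lemma hull_function_measurable u : hull_function u -> measurable_fun [set: measurableTypeR R] u.
Proof. by case=> u_homo _ _; apply: nondecreasing_measurable => // s t _ _; exact: u_homo. Qed.

Lemma measurable_circle_hull u : hull_function u ->
  measurable_fun [set: measurableTypeR R] (@to_circle R \o u : R -> borel_circle R).
Proof.
move=> hu; apply: measurableT_comp; first exact: measurable_to_circle.
exact: hull_function_measurable.
Qed.

Definition hull_measure u (hu : hull_function u) : circle_measure R :=
  distribution (uniform_prob (@ltr01 R))
    (mfun_Sub (mem_set (measurable_circle_hull hu))).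

(** For nonnegative functions this is the change of variables for an image
    measure and a density; a bounded function becomes nonnegative after adding a
    constant. *)
Lemma integral_hull_measure u (hu : hull_function u) f :
  \int[hull_measure hu]_t f t = \int[mu]_(s in `[0, 1]) f (to_circle (u s)).
Proof.
have [C fC] := circle_fun_bounded f.
have mf := measurable_circle_fun f.
have mfu := measurableT_comp mf (measurable_circle_hull hu).
have intf (P : probability (borel_circle R) R) : P.-integrable setT (EFin \o f).
  apply: measurable_bounded_integrable => //.
    exact: (le_lt_trans (probability_le1 P measurableT) (ltry 1)).
  exists C; split; first exact: num_real.
  by move=> M CM s _; apply: le_trans (fC s) (ltW CM).
have intC (P : probability (borel_circle R) R) : P.-integrable setT (EFin \o (fun=> C)).
  by apply: finite_measure_integrable_cst.
apply: (addIr C).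
have {1}-> : C = \int[hull_measure hu]_t C.
  rewrite Rintegral_cst// -[LHS]mulr1; congr (_ * _).
  by rewrite /= probability_setT.
rewrite [X in _ = _ + X](_ : C = \int[mu]_(s in `[0, 1]) C); last first.
  by rewrite unit_integral_cst.
rewrite -RintegralD//; last 2 first.
- exact: intf.
- exact: intC.
rewrite -RintegralD//; last 2 first.
- by apply: (@bounded_itv_integrable _ _ C) => //; exact: segment_finite.
- by apply: (@bounded_itv_integrable _ _ `|C|) => //; exact: segment_finite.
rewrite /Rintegral; congr fine; rewrite ge0_integral_distribution//=; last 2 first.
- by apply/measurable_EFinP; apply: measurable_funD.
- by move=> t; rewrite lee_fin; have := fC t; rewrite ler_norml => /andP[? _]; lra.
rewrite integral_uniform ?subr0 ?invr1 ?mul1e//.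
- by apply/measurable_EFinP; apply: measurable_funD.
- by move=> t; rewrite lee_fin; have := fC (to_circle (u t)); rewrite ler_norml => /andP[? _]; lra.
Qed.

Lemma hull_measure_is_lamination_measure u (hu : hull_function u) :
  is_lamination_measure omega (hull_set omega u) (hull_measure hu).
Proof.
move=> x ux f; rewrite integral_hull_measure.
have [t tx] := hull_set_at_phase hu ux.
have [C fC] := circle_fun_bounded f.
pose h := fun s => f (to_circle (u s)).
have mh : measurable_fun [set: measurableTypeR R] h.
  exact: measurableT_comp (measurable_circle_fun f) (measurable_circle_hull hu).
rewrite -(@Rintegral_periodic _ h C t)//.
- by apply: eq_Rintegral => s _; rewrite (lower_hull_at_phase omega_irr s hu tx).
- by move=> s; exact: fC.
- by move=> s; have [_ u1 _] := hu; rewrite /h u1 -[1]/(1%:~R) to_circle_shift.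
Qed.

(** The measure of a lamination is specified by its integrals and not
    constructed, so a measure with these integrals, the image of Lebesgue measure
    under the hull function, has to be exhibited first. *)
Lemma integrate_lamination_measure u f : hull_function u ->
  integrate (lamination_measure omega (hull_set omega u)) f =
  \int[mu]_(s in `[0, 1]) f (to_circle (u s)).
Proof.
move=> hu; set m := lamination_measure _ _.
have hm : is_lamination_measure omega (hull_set omega u) m.
  exact: xgetPex (ex_intro _ _ (hull_measure_is_lamination_measure hu)).
have ux := @hull_conf_hull_set _ _ omega u 0.
by rewrite /integrate (hm _ ux f) -(hull_measure_is_lamination_measure hu ux f) integral_hull_measure.
Qed.

End LaminationMeasure.

(** * Step functions and their weights *)

Section CircleBump.
Context {R : realType}.
Implicit Types (x y r : R) (k : int).

Definition int_dist x : R :=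
  Num.min (x - (Num.floor x)%:~R) ((Num.floor x)%:~R + 1 - x).

Lemma int_dist_ge0 x : 0 <= int_dist x.
Proof.
have := floor_le x; have := floorD1_gt x; rewrite intrD => h1 h2.
by rewrite /int_dist le_min; apply/andP; split; lra.
Qed.

Lemma int_dist_attained x : exists k, int_dist x = `|x - k%:~R|.
Proof.
have := floor_le x; have := floorD1_gt x; rewrite intrD => h1 h2.
rewrite /int_dist; have [_|_] := leP (x - _) (_ - x).
  by exists (Num.floor x); rewrite ger0_norm; lra.
by exists (Num.floor x + 1); rewrite intrD ler0_norm; lra.
Qed.

Lemma int_dist_le x k : int_dist x <= `|x - k%:~R|.
Proof.
have := floor_le x; have := floorD1_gt x; rewrite intrD /int_dist => h1 h2.
have [kn|kn] := leP k (Num.floor x).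
  have kn' : k%:~R <= (Num.floor x)%:~R :> R by rewrite ler_int.
  by rewrite ge_min ger0_norm; [apply/orP; left; lra|lra].
have kn' : (Num.floor x + 1)%:~R <= k%:~R :> R by rewrite ler_int lezD1.
by rewrite intrD in kn'; rewrite ge_min ler0_norm; [apply/orP; right; lra|lra].
Qed.

Lemma int_dist_shift x k : int_dist (x + k%:~R) = int_dist x.
Proof.
have shift_le y l : int_dist (y + l%:~R) <= int_dist y.
  have [n ->] := int_dist_attained y.
  apply: le_trans (int_dist_le _ (n + l)) _.
  by rewrite (_ : y + l%:~R - (n + l)%:~R = y - n%:~R)// intrD; ring.
apply/le_anti; rewrite shift_le /=.
by have := shift_le (x + k%:~R) (- k); rewrite intrN addrK.
Qed.

Lemma int_dist_lipschitz x y : int_dist x <= int_dist y + `|x - y|.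
Proof.
have [k ->] := int_dist_attained y; apply: le_trans (int_dist_le x k) _.
by rewrite [leRHS]addrC (_ : x - k%:~R = (x - y) + (y - k%:~R)); [exact: ler_normD|ring].
Qed.

Lemma int_dist_continuous : continuous int_dist.
Proof.
move=> x; apply/cvgrPdist_le => e e0; near=> y.
have xy : `|x - y| <= e by near: y; apply: cvgr_dist_le.
have := int_dist_lipschitz x y; have := int_dist_lipschitz y x.
by rewrite distrC ler_norml => *; apply/andP; split; lra.
Unshelve. all: by end_near. Qed.

(** A continuous periodic cutoff: equal to [1] up to distance [e] from the
    integers and to [0] from distance [2 * e] on. *)
Definition bump (e : R) x : R := Num.min 1 (Num.max 0 (2 - int_dist x / e)).

Lemma bump_continuous e : continuous (bump e).
Proof.
move=> x; pose g y := 2 - int_dist y / e.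
apply: (@continuous_min R R (fun=> 1) (fun y => Num.max 0 (g y)) x).
  exact: cvg_cst.
apply: (@continuous_max R R (fun=> 0) g x); first exact: cvg_cst.
apply: cvgB; first exact: cvg_cst.
by apply: cvgM; [exact: int_dist_continuous|exact: cvg_cst].
Qed.

Lemma bump_shift e x k : bump e (x + k%:~R) = bump e x.
Proof. by rewrite /bump int_dist_shift. Qed.

Lemma bump1 e x k : 0 < e -> `|x - k%:~R| <= e -> bump e x = 1.
Proof.
move=> e0 xk; have := le_trans (int_dist_le x k) xk.
by rewrite -[X in _ <= X]mul1r -ler_pdivrMr// /bump => ?; rewrite min_l// le_max; apply/orP; right; lra.
Qed.

Lemma bump0 e x : 0 < e -> 2 * e <= int_dist x -> bump e x = 0.
Proof.
move=> e0; rewrite -ler_pdivlMr// /bump => ?; rewrite max_l ?min_r//; lra.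
Qed.

Section OnCircle.
Variables (e c : R).
Let g r := bump e (r - c).

Definition circle_bump_fun : circle R -> R := g \o repr.

Lemma circle_bump_continuous : continuous circle_bump_fun.
Proof.
apply: repr_comp_continuous.
  move=> r; apply: (@continuous_comp _ _ _ (fun r => r - c) (bump e)); last first.
    exact: bump_continuous.
  by apply: cvgB; [exact: cvg_id|exact: cvg_cst].
move=> r s /eqP/eqquotP; rewrite /congruent1/= => /intrP[k rs].
apply/eqP; rewrite /g -(bump_shift e (s - c) k) -rs; congr bump; ring.
Qed.

Definition circle_bump : continuousType (circle R) R :=
  mkcts circle_bump_continuous.

Lemma circle_bumpE r : circle_bump (to_circle r) = bump e (r - c).
Proof.
rewrite /circle_bump /= /circle_bump_fun /= /g.
have : congruent1 (repr (to_circle r)) r by apply/eqquotP; exact: reprK.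
move=> /intrP[k rs].
by rewrite -(bump_shift e (r - c) k) -rs; congr bump; ring.
Qed.

End OnCircle.

End CircleBump.

Section StepFunctions.
Context {R : realType} {N : nat}.
Variable m : 'I_N -> R.
Implicit Types (p : 'rV[R]_N) (r s t e : R) (phi : R -> R).
Local Notation mu := (@lebesgue_measure R).
Local Notation simplex := (simplex R N).

Definition lattice r : Prop := exists a, r - m a \is a Num.int.

(** The lift to the line of the distribution function of the measure on the
    circle that gives mass [p a] to [m a]. *)
Definition step_cdf p r : R := \sum_a p ord0 a * (Num.floor (r - m a))%:~R.

Definition spread : R := \sum_a `|m a|.

Lemma simplex_ge0 p a : simplex p -> 0 <= p ord0 a. Proof. by case=> _; exact. Qed.

Lemma step_cdf_homo p : simplex p -> {homo step_cdf p : r s / r <= s}.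
Proof.
move=> hp r s rs; apply: ler_sum => a _; apply: ler_wpM2l; first exact: simplex_ge0.
by rewrite ler_int; apply: le_floor; rewrite lerD2r.
Qed.

Lemma step_cdf_shift p r : simplex p -> step_cdf p (r + 1) = step_cdf p r + 1.
Proof.
move=> hp; rewrite -[in RHS]hp.1 -big_split; apply: eq_bigr => a _ /=.
by rewrite addrAC floorDrz ?rpred1// floor1 intrD mulrDr mulr1.
Qed.

Lemma step_cdf_bound p r : simplex p ->
  r - 1 - spread <= step_cdf p r <= r + spread.
Proof.
move=> hp.
have split_r q : q = \sum_a p ord0 a * q by rewrite -mulr_suml hp.1 mul1r.
have p_le1 a : p ord0 a <= 1.
  rewrite -[X in _ <= X]hp.1 (bigD1 a)//= lerDl; apply: sumr_ge0 => b _; exact: simplex_ge0.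
have pm a : `|p ord0 a * m a| <= `|m a|.
  by rewrite normrM ger0_norm ?simplex_ge0// ler_piMl.
rewrite /spread; apply/andP; split.
  rewrite lerBlDr [X in X <= _]split_r -big_split; apply: ler_sum => a _ /=.
  have := floorD1_gt (r - m a); rewrite intrD => h.
  have := pm a; rewrite ler_norml => /andP[h1 h2].
  have := ler_wpM2l (simplex_ge0 a hp) (ltW h); rewrite !mulrDr mulrN; lra.
rewrite [X in _ <= X + _]split_r -big_split; apply: ler_sum => a _ /=.
have := ler_wpM2l (simplex_ge0 a hp) (floor_le (r - m a)); rewrite mulrBr.
by have := pm a; rewrite ler_norml => /andP[h1 h2]; lra.
Qed.

Lemma step_cdf_right p r : exists2 e, 0 < e &
  forall s, r <= s < r + e -> step_cdf p s = step_cdf p r.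
Proof.
have : \forall e \near 0^'+, forall a, e < (Num.floor (r - m a) + 1)%:~R - (r - m a).
  apply: filter_forall => a; apply: nbhs_right_lt.
  by rewrite subr_gt0; exact: floorD1_gt.
move=> nr; have [e [e0 he]] : exists e, 0 < e /\ forall a, e < (Num.floor (r - m a) + 1)%:~R - (r - m a).
  near (0 : R)^'+ => e; exists e; split; near: e => //; exact: nbhs_right_gt.
exists e => // s /andP[rs sr]; apply: eq_bigr => a _; congr (_ * _%:~R).
apply: floor_def; have := he a; rewrite intrD => h.
by have := floor_le (r - m a) => h'; apply/andP; split; lra.
Unshelve. all: by end_near. Qed.

Lemma step_cdf_left p r : exists2 e, 0 < e & forall s, r - e <= s < r ->
  step_cdf p s = step_cdf p r - \sum_(a | r - m a \is a Num.int) p ord0 a.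
Proof.
pose gap a := r - m a - (Num.floor (r - m a))%:~R.
have gap_ge0 a : 0 <= gap a by rewrite subr_ge0 floor_le.
have : \forall e \near 0^'+, forall a, e < (if gap a == 0 then 1 else gap a).
  apply: filter_forall => a; apply: nbhs_right_lt; case: eqP => // /eqP.
  by rewrite lt_def gap_ge0 andbT.
move=> nr; have [e [e0 he]] : exists e, 0 < e /\ forall a, e < (if gap a == 0 then 1 else gap a).
  near (0 : R)^'+ => e; exists e; split; near: e => //; exact: nbhs_right_gt.
exists e => // s /andP[sr rs].
rewrite [in RHS]big_mkcond -sumrB; apply: eq_bigr => a _ /=.
rewrite intrEfloor; have := he a; have := gap_ge0 a.
have -> : (gap a == 0) = ((Num.floor (r - m a))%:~R == r - m a).
  by rewrite /gap subr_eq0 eq_sym.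
have := floorD1_gt (r - m a); rewrite /gap intrD.
case: eqP => [rE|_] h1 h2 h3.
  have -> : Num.floor (s - m a) = Num.floor (r - m a) - 1.
    by apply: floor_def; rewrite subrK intrB; apply/andP; split; lra.
  by rewrite intrB mulrBr mulr1.
rewrite subr0; congr (_ * _%:~R); apply: floor_def; rewrite intrD.
by apply/andP; split; lra.
Unshelve. all: by end_near. Qed.

(** The generalised inverse of [step_cdf p]. It takes each value
    [m a + l], [l] an integer, on an interval of length [p a], and these intervals
    are ordered as the values are. *)
Definition step_hull p s : R := inf [set r | s <= step_cdf p r].

(** The defining adjunction of the two monotone functions; every property of
    [step_hull] is read off from it. *)
Lemma step_hull_le p s r : simplex p -> (step_hull p s <= r) = (s <= step_cdf p r).
Proof.
move=> hp; set E := [set r | s <= step_cdf p r].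
have infE : has_inf E.
  split.
    by exists (s + 1 + spread); rewrite /E/=; have /andP[] := step_cdf_bound (s + 1 + spread) hp; lra.
  exists (s - spread) => q; rewrite /E/= => sq.
  by have /andP[_] := step_cdf_bound q hp; lra.
apply/idP/idP => [|sr]; last by apply: ge_inf => //; case: infE.
suff h : s <= step_cdf p (step_hull p s).
  by move/(step_cdf_homo hp); exact: le_trans.
have [e e0 he] := step_cdf_right p (step_hull p s).
have [q Eq qe] := inf_adherent e0 infE.
have qi : step_hull p s <= q by apply: ge_inf => //; case: infE.
by rewrite -(he q) ?qi.
Qed.

Lemma le_step_cdf_hull p s : simplex p -> s <= step_cdf p (step_hull p s).
Proof. by move=> hp; rewrite -step_hull_le. Qed.

Lemma step_hull_hull_function p : simplex p -> hull_function (step_hull p).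
Proof.
move=> hp; split.
- by move=> s t st; rewrite step_hull_le//; apply: le_trans st (le_step_cdf_hull _ hp).
- move=> s; apply/le_anti; rewrite step_hull_le// step_cdf_shift// lerD2r.
  rewrite le_step_cdf_hull//= -lerBrDr step_hull_le//.
  rewrite -(lerD2r 1) -step_cdf_shift// subrK; exact: le_step_cdf_hull.
- move=> s e e0.
  have : ~~ (step_hull p s <= step_hull p s - e) by rewrite -ltNge; lra.
  rewrite step_hull_le// -ltNge => h.
  exists ((step_cdf p (step_hull p s - e) + s) / 2); first lra.
  by rewrite ltNge step_hull_le// -ltNge; lra.
Qed.

Lemma step_hull_lattice p s : simplex p -> lattice (step_hull p s).
Proof.
move=> hp; apply: contrapT => nl.
have [e e0 he] := step_cdf_left p (step_hull p s).
have := le_step_cdf_hull s hp; rewrite -[X in _ <= X]subr0.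
have -> : 0 = \sum_(a | step_hull p s - m a \is a Num.int) p ord0 a.
  by rewrite big_pred0// => a; apply/negbTE/negP => h; apply: nl; exists a.
rewrite -(he (step_hull p s - e)); last by apply/andP; split; lra.
rewrite -step_hull_le//; lra.
Qed.

Lemma step_hull_bound p s : simplex p -> `|step_hull p s - s| <= 1 + spread.
Proof.
move=> hp; rewrite ler_norml; apply/andP; split.
  have /andP[_ h] := step_cdf_bound (step_hull p s) hp.
  by have := le_step_cdf_hull s hp; lra.
rewrite lerBlDr step_hull_le//.
have /andP[h _] := step_cdf_bound (1 + spread + s) hp; lra.
Qed.

Lemma step_cdf_cvg {T : Type} (F : set_system T) (FF : Filter F)
    (p_ : T -> 'rV[R]_N) p r :
  (forall a, p_ q ord0 a @[q --> F] --> p ord0 a) ->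
  step_cdf (p_ q) r @[q --> F] --> step_cdf p r.
Proof.
move=> pcvg; apply: cvg_big => [|a _]; first exact: add_continuous.
by apply: cvgM; [exact: pcvg|exact: cvg_cst].
Qed.

Definition separated e : Prop :=
  forall r s, lattice r -> lattice s -> `|r - s| < e -> r = s.

(** Since the values lie in a discrete set and the distribution functions
    converge, the values stabilise at every phase [s] that is not a value of
    the limit distribution function. *)
Lemma step_hull_stable {T : Type} (F : set_system T) (FF : Filter F)
    (p_ : T -> 'rV[R]_N) p s e : 0 < e -> separated e ->
  (forall q, simplex (p_ q)) -> simplex p ->
  (forall a, p_ q ord0 a @[q --> F] --> p ord0 a) ->
  (forall r, s <> step_cdf p r) ->
  \forall q \near F, step_hull (p_ q) s = step_hull p s.
Proof.
move=> e0 sep hp_ hp pcvg s_reg; set r := step_hull p s.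
have s_lt : s < step_cdf p r.
  by rewrite lt_def le_step_cdf_hull// andbT; apply/eqP => /esym/s_reg.
have lt_s : step_cdf p (r - e) < s.
  by rewrite ltNge -step_hull_le// -ltNge /r; lra.
near=> q; apply: sep; [exact: step_hull_lattice|exact: step_hull_lattice|].
have h1 : step_hull (p_ q) s <= r.
  by rewrite step_hull_le//; near: q; exact: (cvgr_ge (step_cdf p r) (step_cdf_cvg FF (r := r) pcvg) _ s_lt).
have h2 : r - e < step_hull (p_ q) s.
  by rewrite ltNge step_hull_le// -ltNge; near: q; exact: (cvgr_lt (step_cdf p (r - e)) (step_cdf_cvg FF (r := r - e) pcvg) _ lt_s).
by rewrite ltr_norml; apply/andP; split; lra.
Unshelve. all: by end_near. Qed.

Lemma countable_step_cdf p : countable (range (step_cdf p)).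
Proof.
pose f (v : {ffun 'I_N -> int}) : R := \sum_a p ord0 a * (v a)%:~R.
apply: (@sub_countable _ _ _ (range f)).
  apply: subset_card_le => _ [r _ <-]; exists [ffun a => Num.floor (r - m a)] => //.
  by apply: eq_bigr => a _; rewrite ffunE.
by apply: (sub_countable (card_image_le _ _)); exact: countableP.
Qed.

Section Weights.
Variables (phi : R -> R) (ind : 'I_N -> R -> R).
Hypothesis hphi : hull_function phi.
Hypothesis ind_measurable : forall a,
  measurable_fun [set: measurableTypeR R] (ind a).
Hypothesis ind_value : forall s, exists2 a, phi s - m a \is a Num.int &
  forall b, ind b s = (b == a)%:R.

Definition weights : 'rV[R]_N := \row_a \int[mu]_(s in `[0, 1]) ind a s.

Lemma ind_bound a s : `|ind a s| <= 1.
Proof. by have [b _ ->] := ind_value s; case: eqP; rewrite ?normr1 ?normr0. Qed.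

Lemma ind_integrable a : mu.-integrable `[0%R, 1%R]%classic (EFin \o ind a).
Proof.
apply: (@bounded_itv_integrable _ _ 1) => //.
- exact: ind_bound.
- exact: segment_finite.
Qed.

Lemma Rintegral_ind_sum (c : 'I_N -> R) :
  \int[mu]_(s in `[0, 1]) (\sum_a ind a s * c a) = \sum_a weights ord0 a * c a.
Proof.
have intZ a : mu.-integrable `[0%R, 1%R]%classic (EFin \o (fun s => ind a s * c a)).
  apply: (@bounded_itv_integrable _ _ `|c a|) => //.
  - by apply: measurable_funM => //; exact: measurable_cst.
  - by move=> s; rewrite normrM ler_piMl// ind_bound.
  - exact: segment_finite.
transitivity (\sum_a \int[mu]_(s in `[0, 1]) (ind a s * c a)); last first.
  apply: eq_bigr => a _; rewrite mxE RintegralZr//; exact: ind_integrable.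
pose G (n : seq 'I_N) := \int[mu]_(s in `[0, 1]) (\sum_(a <- n) ind a s * c a).
suff : forall n, mu.-integrable `[0%R, 1%R]%classic (EFin \o (fun s => \sum_(a <- n) ind a s * c a))
   /\ G n = \sum_(a <- n) \int[mu]_(s in `[0, 1]) (ind a s * c a).
  by move/(_ (index_enum 'I_N)) => [].
elim=> [|a n [IHi IHe]].
  rewrite /G; under eq_Rintegral do rewrite big_nil; rewrite big_nil unit_integral_cst; split=> //.
  under [X in EFin \o X]eq_fun do rewrite big_nil.
  by apply: (@bounded_itv_integrable _ _ 0) => //; [move=> s; rewrite normr0|exact: segment_finite].
rewrite /G; under eq_Rintegral do rewrite big_cons; rewrite big_cons -IHe RintegralD//; split=> //.
under [X in EFin \o X]eq_fun do rewrite big_cons.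
by have := integrableD _ (intZ a) IHi; apply.
Qed.

Lemma weights_simplex : simplex weights.
Proof.
split.
  have := Rintegral_ind_sum (fun=> 1); under [in RHS]eq_bigr do rewrite mulr1.
  move=> <-; rewrite -[RHS]unit_integral_cst; apply: eq_Rintegral => s _.
  have [a _ ha] := ind_value s; rewrite (bigD1 a)//= big1 ?addr0 ?ha ?eqxx ?mulr1//.
  by move=> b ba; rewrite ha (negbTE ba) mul0r.
move=> a; rewrite mxE; apply: Rintegral_ge0 => s _.
by have [b _ ->] := ind_value s; exact: ler0n.
Qed.

Let level r : R := sup [set s | phi s <= r].

Let phi_le r s : (phi s <= r) = (s <= level r).
Proof.
have [phi_homo _ phi_left] := hphi.
have b s' := hull_bound s' hphi.
have supE : has_sup [set s | phi s <= r].
  split.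
    exists (r - phi 0 - 1) => /=; have := b (r - phi 0 - 1).
    by rewrite ler_norml => /andP[_]; lra.
  exists (r - phi 0 + 1) => t /= ht; have := b t.
  by rewrite ler_norml => /andP[]; lra.
apply/idP/idP => [h|h]; first exact: (sup_upper_bound supE).
apply: le_trans (phi_homo _ _ h) _; rewrite leNgt; apply/negP => h2.
have [|t tl ht] := phi_left (level r) (phi (level r) - r); first lra.
have [t' /= ht' tt'] := @sup_adherent R _ (level r - t) ltac:(lra) supE.
rewrite -/(level r) in tt'.
have := phi_homo t t'; lra.
Qed.

Let floor_level r s : Num.floor (r - phi s) = Num.floor (level r - s).
Proof.
have iff (l : int) : (l <= Num.floor (r - phi s)) = (l <= Num.floor (level r - s)).
  rewrite !floor_ge_int !lerBrDr addrC -hull_shift// phi_le; congr (_ <= _); ring.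
by apply/le_anti; rewrite -iff lexx iff lexx.
Qed.

Let Rintegral_floor x : exists2 g : R -> R,
  mu.-integrable `[0%R, 1%R]%classic (EFin \o g) & 
  (forall s, 0 <= s <= 1 -> (Num.floor (x - s))%:~R = g s) /\ \int[mu]_(s in `[0, 1]) g s = x - 1.
Proof.
pose n := Num.floor x; pose th := x - n%:~R.
have th0 : 0 <= th by rewrite subr_ge0 floor_le.
have th1 : th < 1 by have := floorD1_gt x; rewrite intrD /th /n; lra.
pose i : R -> R := \1_(`[0, th]%classic).
have intc (c : R) : mu.-integrable `[0%R, 1%R]%classic (EFin \o (fun=> c)).
  by apply: (@bounded_itv_integrable _ _ `|c|) => //; exact: segment_finite.
have inti : mu.-integrable `[0%R, 1%R]%classic (EFin \o i).
  apply: (@bounded_itv_integrable _ _ 1); last exact: segment_finite.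
    exact: measurable_indic.
  by move=> s; rewrite /i indicE; case: (_ \in _); rewrite ?normr1 ?normr0.
exists (fun s => n%:~R - 1 + i s).
  by have := integrableD _ (intc (n%:~R - 1)) inti; apply.
split.
  move=> s /andP[s0 s1]; rewrite /i indicE; case: (boolP (s \in _)).
    rewrite inE/= in_itv/= => /andP[_ st]; rewrite subrK; congr (_%:~R).
    by apply: floor_def; rewrite intrD; apply/andP; split; rewrite /th in st th0 th1; lra.
  rewrite notin_setE/= in_itv/= s0/= => /negP; rewrite -ltNge => st.
  rewrite addr0 -(intrB _ n 1); congr (_%:~R).
  by apply: floor_def; rewrite subrK intrB; apply/andP; split; rewrite /th in st th0 th1; lra.
rewrite RintegralD// unit_integral_cst /Rintegral /i integral_indic//=.
rewrite (_ : _ `&` _ = `[0, th]%classic); last first.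
  apply/seteqP; split=> s /=; rewrite !in_itv/=; first by case.
  by move=> /andP[s0 st]; rewrite s0 st; split=> //; lra.
rewrite lebesgue_measure_itv/= lte_fin; case: ltP => [_|h].
  by rewrite -EFinB subr0/= /th; ring.
by have -> : x = n%:~R; [rewrite /th in th0 h *; lra|rewrite addr0].
Qed.

Let level_weights r : level r - level 0 = step_cdf weights r - step_cdf weights 0.
Proof.
have [g1 int1 [g1E I1]] := Rintegral_floor (level r).
have [g2 int2 [g2E I2]] := Rintegral_floor (level 0).
transitivity (\int[mu]_(s in `[0, 1]) (g1 s - g2 s)).
  by rewrite RintegralB// I1 I2; ring.
pose c a : R := (Num.floor (r - m a))%:~R - (Num.floor (0 - m a))%:~R.
transitivity (\int[mu]_(s in `[0, 1]) (\sum_a ind a s * c a)).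
  apply: eq_Rintegral => s; rewrite inE/= in_itv/= => s01.
  rewrite -g1E// -g2E// -!floor_level.
  have [a /intrP[l la] ha] := ind_value s.
  rewrite (bigD1 a)//= big1 ?addr0 => [|b ba]; last by rewrite ha (negbTE ba) mul0r.
  have shift q : Num.floor (q - phi s) = Num.floor (q - m a) - l.
    have -> : q - phi s = q - m a + (- l)%:~R by rewrite intrN -la; ring.
    by rewrite floorDrz ?intr_int// intrKfloor.
  by rewrite !shift ha eqxx mul1r /c !intrB; ring.
rewrite Rintegral_ind_sum /c -sumrB; apply: eq_bigr => a _; rewrite mulrBr//.
Qed.

(** [floor (r - phi s)] counts the integers [l] with [phi (s + l) <= r], that
    is with [s + l <= level r], where [level] is the generalised inverse of
    [phi]. Its mean over a period is [level r - 1] when computed from the right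
    side, and is affine in the weights when computed from the left side, because
    there the floor is known on each level set of [phi]. So the weights
    determine [level], hence [phi], up to a translation. *)
Lemma hull_function_weights : exists c, forall s, phi s = step_hull weights (s + c).
Proof.
exists (step_cdf weights 0 - level 0) => s.
have ws := weights_simplex.
have iff r : (phi s <= r) = (step_hull weights (s + (step_cdf weights 0 - level 0)) <= r).
  rewrite phi_le step_hull_le//; have := level_weights r => h.
  by apply/idP/idP; lra.
by apply/le_anti; rewrite -iff lexx iff lexx.
Qed.

End Weights.

Lemma weights_step_hull (ind : 'I_N -> R -> R) p :
  (forall a b, a != b -> m a - m b \isn't a Num.int) ->
  simplex p ->
  (forall a, measurable_fun [set: measurableTypeR R] (ind a)) ->
  (forall s, exists2 a, step_hull p s - m a \is a Num.int &
     forall b, ind b s = (b == a)%:R) ->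
  weights ind = p.
Proof.
move=> m_distinct hp ind_meas ind_val.
have hphi := step_hull_hull_function hp.
have [c hc] := hull_function_weights hphi ind_meas ind_val.
have ws := weights_simplex ind_meas ind_val.
have cdfE r : step_cdf (weights ind) r = step_cdf p r + c.
  apply/le_anti/andP; split.
    by rewrite -lerBlDr -step_hull_le// hc step_hull_le// subrK.
  by rewrite -step_hull_le// -hc step_hull_le.
apply/rowP => a; rewrite -[0]/(ord0).
have jump (q : 'rV[R]_N) : exists2 e, 0 < e & forall s, m a - e <= s < m a ->
    q ord0 a = step_cdf q (m a) - step_cdf q s.
  have [e e0 he] := step_cdf_left q (m a); exists e => // s /he ->.
  rewrite (bigD1 a)/= ?subrr ?rpred0// big_pred0 ?addr0 => [|b]; first by ring.
  by apply/negbTE/negP => /andP[h ba]; move: h; apply/negP/m_distinct; rewrite eq_sym.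
have [e1 e10 h1] := jump (weights ind); have [e2 e20 h2] := jump p.
have [e [e0 ee1 ee2]] : exists e, [/\ 0 < e, e <= e1 & e <= e2].
  by exists (Num.min e1 e2); rewrite lt_min e10 e20 !ge_min !lexx orbT.
rewrite (h1 (m a - e)); last by apply/andP; split; lra.
rewrite (h2 (m a - e)); last by apply/andP; split; lra.
rewrite !cdfE; ring.
Qed.

End StepFunctions.

(** * The force exerted by the interaction *)

Section Lattice.
Context {d : nat}.
Implicit Types (i j k : 'rV[int]_d) (n r : nat).

Lemma norm1_eq0 i : norm1 i = 0%N -> i = 0.
Proof.
move=> /eqP; rewrite sum_nat_eq0 => /forallP h; apply/rowP => a.
by rewrite mxE; apply/eqP; rewrite -absz_eq0; exact: (h a).
Qed.

Lemma norm1N i : norm1 (- i) = norm1 i.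
Proof. by apply: eq_bigr => a _; rewrite mxE abszN. Qed.

Lemma norm1D i k : (norm1 (i + k) <= norm1 i + norm1 k)%N.
Proof. by rewrite /norm1 -big_split leq_sum// => a _; rewrite mxE /=; lia. Qed.

(** [Z^d] is connected by steps to nearest neighbours. *)
Lemma norm1_ind (P : 'rV[int]_d -> Prop) i :
  P i -> (forall j k, P j -> norm1 (j - k) = 1%N -> P k) -> forall k, P k.
Proof.
move=> Pi Pstep k; move En: (norm1 (k - i)) => n.
elim: n k En => [|n IHn] k En.
  by have /eqP := norm1_eq0 En; rewrite subr_eq0 => /eqP ->.
have [a ka] : exists a, (k - i) ord0 a != 0.
  apply: contrapT => h; suff : norm1 (k - i) = 0%N by rewrite En.
  rewrite /norm1 big1// => a _; apply/eqP; rewrite absz_eq0.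
  by apply: contrapT => /negP ka; apply: h; exists a.
pose s : int := Num.sg ((k - i) ord0 a).
pose v : 'rV[int]_d := \row_b (if b == a then s else 0).
have v1 : norm1 v = 1%N.
  rewrite /norm1 (bigD1 a)//= big1 => [|b ba]; rewrite !mxE ?(negbTE ba)//.
  by rewrite eqxx addn0 /s; case: sgrP ka => //; rewrite ?eqxx.
apply: (Pstep (k - v)); last by rewrite addrAC subrr add0r norm1N.
apply: IHn; apply/eqP; rewrite -(eqn_add2r 1) !addn1 -En -addn1 /norm1.
rewrite (bigD1 a)//= [X in _ == X](bigD1 a)//= addnAC.
rewrite (eq_bigr (fun b => absz ((k - i)%R ord0 b))) => [|b ba]; last first.
  by rewrite !mxE (negbTE ba) subr0.
rewrite eqn_add2r !mxE eqxx /s !mxE; move: ka; rewrite !mxE.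
by case: sgrP => //; lia.
Qed.

Lemma finite_ball1 n j : finite_set (ball1 n j).
Proof.
pose f (v : {ffun 'I_d -> 'I_(n + n).+1}) : 'rV[int]_d :=
  \row_a (j ord0 a + (val (v a))%:Z - n%:Z).
apply: (@sub_finite_set _ _ (f @` [set` predT])).
  move=> k; rewrite /ball1/= => kn.
  exists [ffun a => inord (absz ((k - j) ord0 a + n%:Z))] => //.
  apply/rowP => a; rewrite !mxE ffunE /=.
  have : (absz ((k - j)%R ord0 a) <= n)%N.
    by apply: leq_trans kn; rewrite /norm1 (bigD1 a)//= leq_addr.
  rewrite !mxE -[k 0 a]/(k ord0 a).
  by move: (k ord0 a) (j ord0 a) => u v uv; rewrite inordK; clear -uv; lia.
by apply: finite_image; exact: finite_finpred.
Qed.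

Definition ball_seq n j : seq 'rV[int]_d :=
  [seq j + k | k <- finmap.enum_fset (fset_set (ball1 n 0))].

Lemma mem_ball_seq n j k : (k \in ball_seq n j) = (norm1 (k - j) <= n)%N.
Proof.
have mem0 (q : 'rV[int]_d) : (q \in finmap.enum_fset (fset_set (ball1 n 0))) = (norm1 q <= n)%N.
  have := in_fset_set (@finite_ball1 n 0) q; rewrite /ball1 => ->.
  by apply/idP/idP; rewrite inE/= subr0.
apply/mapP/idP => [[q + ->]|h]; first by rewrite mem0 addrAC subrr add0r.
by exists (k - j); rewrite ?mem0// addrC subrK.
Qed.

Lemma ball_seq_uniq n j : uniq (ball_seq n j).
Proof. by rewrite map_inj_uniq ?finmap.fset_uniq//; exact: addrI. Qed.

Lemma size_ball_seq n j : size (ball_seq n j) = size (ball_seq n 0).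
Proof. by rewrite !size_map. Qed.

Lemma ball_seq_shift n i k : ball_seq n (i + k) = [seq j + k | j <- ball_seq n i].
Proof. by rewrite /ball_seq -map_comp; apply: eq_map => j /=; rewrite addrAC. Qed.

End Lattice.

Section PartialDerivatives.
Context {R : realType}.

Lemma seq_bounded {I : eqType} {Y : Type} (s : seq I) (F : I -> Y -> R) (Q : set Y) :
  (forall i, exists A, forall y, Q y -> `|F i y| <= A) ->
  exists2 A, 0 <= A & forall i y, i \in s -> Q y -> `|F i y| <= A.
Proof.
move=> hF; elim: s => [|i s [A A0 hA]]; first by exists 0.
have [B hB] := hF i; exists (Num.max A B); first by rewrite le_max A0.
move=> k y; rewrite inE => /predU1P[->|ks] Qy; rewrite le_max.
  by rewrite hB ?orbT.
by rewrite hA.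
Qed.

Lemma continuous_sum {T : topologicalType} {J : Type} (s : seq J) (F : J -> T -> R) :
  (forall j, continuous (F j)) -> continuous (fun x => \sum_(j <- s) F j x).
Proof.
move=> cF; elim: s => [|j s IHs] x.
  by under eq_fun do rewrite big_nil; exact: cvg_cst.
rewrite (_ : (fun x => _) = fun x => F j x + \sum_(j <- s) F j x); last first.
  by apply/funext => y; rewrite big_cons.
by apply: cvgD; [exact: cF|exact: IHs].
Qed.

Lemma ler_sum_size {J : eqType} (s : seq J) (F : J -> R) A :
  (forall j, j \in s -> F j <= A) -> \sum_(j <- s) F j <= (size s)%:R * A.
Proof.
elim: s => [|j s IHs] FA; first by rewrite big_nil mul0r.
rewrite big_cons /= -natr1 mulrDl mul1r addrC; apply: lerD.
  by apply: IHs => k ks; apply: FA; rewrite inE ks orbT.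
by apply: FA; rewrite inE eqxx.
Qed.

Section OneFunction.
Context {I : eqType}.
Implicit Types (f : {ptws I -> R} -> R) (x y : {ptws I -> R}).

Definition C1 f : Prop := has_partials f /\ forall i, continuous (partial i f).

Definition box (lo hi : I -> R) : set {ptws I -> R} :=
  [set x | forall i, lo i <= x i <= hi i].

Lemma C1_cst0 : C1 (fun=> 0).
Proof.
have p0 i : partial i ((fun=> 0) : {ptws I -> R} -> R) = fun=> 0.
  by apply/funext => x; rewrite /partial derive1_cst.
by split=> i; [move=> x; exact: derivable_cst|rewrite p0; exact: cst_continuous].
Qed.

Lemma box_compact lo hi : compact (box lo hi).
Proof.
rewrite (_ : box lo hi = [set x : forall i : I, R | forall i, `[lo i, hi i]%classic (x i)]).
  by exact: (@tychonoff I (fun=> R) (fun i => `[lo i, hi i]%classic) (fun i => @segment_compact R _ _)).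
by apply/seteqP; split=> x h i; have := h i; rewrite /= in_itv.
Qed.

Lemma continuous_box_bounded f lo hi : (forall i, lo i <= hi i) -> continuous f ->
  exists A, forall x, box lo hi x -> `|f x| <= A.
Proof.
move=> lohi cf.
have [||c _ hc] := @compact_EVT_max _ R (fun x => `|f x|) (box lo hi) _ (@box_compact lo hi).
- by exists lo => i; rewrite lexx lohi.
- apply: continuous_subspaceT => x.
  apply: (@continuous_comp _ _ _ f Num.norm); [exact: cf|exact: norm_continuous].
by exists `|f c| => x bx; apply: hc; rewrite inE.
Qed.

Lemma dfwith_dfwith (x : {ptws I -> R}) i s t : dfwith (dfwith x i s) i t = dfwith x i t.
Proof.
apply/funext => k; have [->|ki] := eqVneq i k; first by rewrite !dfwithin.
by rewrite !dfwithout.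
Qed.

Lemma dfwith_id x i : dfwith x i (x i) = x.
Proof.
apply/funext => k; have [->|ki] := eqVneq i k; first by rewrite !dfwithin.
by rewrite !dfwithout.
Qed.

Lemma partial_MVT f lo hi x i t : has_partials f ->
  box lo hi x -> lo i <= t <= hi i ->
  exists2 y, box lo hi y & f (dfwith x i t) - f x = partial i f y * (t - x i).
Proof.
move=> pf bx bt; pose g s := f (dfwith x i s).
have dg (s : R) : is_derive s (1 : R) g (partial i f (dfwith x i s)).
  have := pf i (dfwith x i s); rewrite /partial dfwithin.
  under eq_fun do rewrite dfwith_dfwith.
  by move=> h; apply: DeriveDef => //; rewrite derive1E.
have cg : continuous g.
  by move=> s; apply/differentiable_continuous/derivable1_diffP; have [] := dg s.
have box_dfwith s : lo i <= s <= hi i -> box lo hi (dfwith x i s).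
  move=> hs k; have [<-|ki] := eqVneq i k; first by rewrite dfwithin.
  by rewrite dfwithout.
have gx : g (x i) = f x by rewrite /g dfwith_id.
have /andP[lox xhi] := bx i; have /andP[lot thi] := bt.
have [xt|/ltW tx] := leP (x i) t.
  have [c + E] := MVT_segment xt (fun s _ => dg s) (continuous_subspaceT cg).
  rewrite in_itv/= => /andP[c1 c2]; exists (dfwith x i c).
    by apply: box_dfwith; apply/andP; split; lra.
  by rewrite -gx -E.
have [c + E] := MVT_segment tx (fun s _ => dg s) (continuous_subspaceT cg).
rewrite in_itv/= => /andP[c1 c2]; exists (dfwith x i c).
  by apply: box_dfwith; apply/andP; split; lra.
by rewrite -gx -[LHS]opprB E; ring.
Qed.

(** The coordinates are changed one at a time, so that the one-variable mean
    value theorem suffices and the partial derivatives are all evaluated at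
    points of the box. *)
Lemma mean_value f lo hi x y (K : seq I) : has_partials f -> uniq K ->
  box lo hi x -> box lo hi y ->
  (forall x' y', (forall k, k \in K -> x' k = y' k) -> f x' = f y') ->
  exists2 c : I -> R, forall k, exists2 z, box lo hi z & c k = partial k f z &
    f y - f x = \sum_(k <- K) c k * (y k - x k).
Proof.
move=> pf uK bx bY fK.
pose mix (L : seq I) : {ptws I -> R} := fun k => if k \in L then y k else x k.
have mix_box L : box lo hi (mix L) by move=> k; rewrite /mix; case: ifP.
suff [c hc E] : exists2 c : I -> R, forall k, exists2 z, box lo hi z & c k = partial k f z &
    f (mix K) - f x = \sum_(k <- K) c k * (y k - x k).
  exists c => //; rewrite -E; congr (_ - _); apply: fK => k kK.
  by rewrite /mix kK.
elim: K uK {fK} => [_|k L IHL /= /andP[kL uL]].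
  exists (fun k => partial k f x) => [k|]; first by exists x.
  by rewrite big_nil subrr.
have [c hc E] := IHL uL.
have [z bz Ez] := partial_MVT pf (mix_box L) (bY k).
exists (fun l => if l == k then partial k f z else c l) => [l|].
  by case: eqP => [->|_]; [exists z|exact: hc].
rewrite big_cons eqxx.
rewrite (eq_big_seq (fun l => c l * (y l - x l))) => [|l lL]; last first.
  by case: eqP => // lk; rewrite lk (negbTE kL) in lL.
rewrite -E; have mixk : mix L k = x k by rewrite /mix (negbTE kL).
rewrite mixk in Ez; rewrite -Ez (_ : dfwith (mix L) k (y k) = mix (k :: L)); first by ring.
apply/funext => l; rewrite /mix inE; have [<-|kl] := eqVneq k l.
  by rewrite dfwithin.
by rewrite dfwithout.
Qed.

End OneFunction.

Section Cylinder.
Context {I : choiceType} (B : set I).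
Let restrict (x : {ptws I -> R}) : {ptws B -> R} := x \o set_val.
Variables (f : {ptws I -> R} -> R) (g : {ptws B -> R} -> R).
Hypothesis fg : forall x, f x = g (restrict x).

Lemma restrict_continuous : continuous restrict.
Proof. by apply/ptws_continuousP => i; exact: ptws_proj_continuous. Qed.

Lemma partial_cylinder_out i x : ~ B i -> partial i f x = 0.
Proof.
move=> Bi; rewrite /partial (_ : (fun t => _) = fun=> f x); first by rewrite derive1_cst.
apply/funext => t; rewrite !fg; congr g; apply/funext => k.
rewrite /restrict/= dfwithout//; apply/eqP => ik; apply: Bi; rewrite ik.
exact: set_valP.
Qed.

Lemma dfwith_cylinder (i : B) x t :
  f (dfwith x (set_val i) t) = g (dfwith (restrict x) i t).
Proof.
rewrite fg; congr g; apply/funext => k; have [<-|ki] := eqVneq i k.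
  by rewrite /restrict/= !dfwithin.
rewrite /restrict/= !dfwithout//; apply: contra ki => /eqP h; apply/eqP.
Qed.

Lemma partial_cylinder (i : B) x : partial (set_val i) f x = partial i g (restrict x).
Proof. by rewrite /partial; congr (derive1 _ _); apply/funext => t; exact: dfwith_cylinder. Qed.

Lemma C1_cylinder : C1 g -> C1 f.
Proof.
move=> [pg cg]; have inB i : B i -> exists k : B, i = set_val k.
  by move=> Bi; exists (SigSub (mem_set Bi)).
split=> i.
  move=> x; have [/inB[k ->]|Bi] := EM (B i).
    rewrite (_ : (fun t => _) = fun t => g (dfwith (restrict x) k t)); first exact: pg.
    by apply/funext => t; exact: dfwith_cylinder.
  rewrite (_ : (fun t => _) = fun=> f x); first exact: derivable_cst.
  apply/funext => t; rewrite !fg; congr g; apply/funext => k.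
  rewrite /restrict/= dfwithout//; apply/eqP => ik; apply: Bi; rewrite ik.
  exact: set_valP.
have [/inB[k ->]|Bi] := EM (B i).
  rewrite (_ : partial _ f = partial k g \o restrict).
    move=> x; apply: continuous_comp; [exact: restrict_continuous|exact: cg].
  by apply/funext => x; exact: partial_cylinder.
rewrite (_ : partial i f = fun=> 0); first exact: cst_continuous.
by apply/funext => x; exact: partial_cylinder_out.
Qed.

End Cylinder.

End PartialDerivatives.

Section Force.
Context {R : realType} {d : nat}.
Local Notation conf := (config R d).
Variable S : 'rV[int]_d -> conf -> R.
Hypothesis S_A : cond_A S.
Hypothesis S_B : cond_B S.
Hypothesis S_C : cond_C S.
Implicit Types (i j k : 'rV[int]_d) (l : int) (x y : conf) (t L : R).

Definition force i x : R := \sum_(j \in [set: 'rV[int]_d]) partial i (S j) x.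

Lemma cond_A_radius : exists2 r : nat, (0 < r)%N & forall j,
  [/\ C1 (S j), forall k, C1 (partial k (S j)),
      forall x y, (forall k, k \in ball_seq r j -> x k = y k) -> S j x = S j y &
      forall i, i \notin ball_seq r j -> partial i (S j) = fun=> 0].
Proof.
have [r r0 [s hs]] := S_A; exists r => // j; have [[cs [ps cps] cps2] Ss] := hs j.
have S1 : C1 (S j) by exact: (@C1_cylinder R _ (ball1 r j) (S j) (s j) Ss (conj ps cps)).
have out i : i \notin ball_seq r j -> partial i (S j) = fun=> 0.
  rewrite mem_ball_seq => ir; apply/funext => x.
  by apply: (partial_cylinder_out Ss); rewrite /ball1/=; exact/negP.
split => // [k|x y xy].
  have [kr|/out ->] := boolP (k \in ball_seq r j); last exact: (@C1_cst0 R).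
  have Bk : ball1 r j k by rewrite /ball1/= -mem_ball_seq.
  apply: (@C1_cylinder R _ (ball1 r j) (partial k (S j)) (partial (SigSub (mem_set Bk) : ball1 r j) (s j))).
    by move=> x; exact: (partial_cylinder Ss (SigSub (mem_set Bk) : ball1 r j)).
  exact: cps2.
rewrite !Ss; congr (s j _); apply/funext => k /=; apply: xy.
by rewrite mem_ball_seq; exact: (set_valP k).
Qed.

Lemma derive1_comp_shift (f : R -> R) a c :
  derive1 (fun t => f (t - c)) (a + c) = derive1 f a.
Proof.
rewrite /derive1 (_ : (fun h => _) = fun h => h^-1 *: (f (h + a) - f a))//.
by apply/funext => h; rewrite addrA !addrK.
Qed.

Lemma partial_translate (f g : conf -> R) i k l x :
  (forall y, f (translate k l y) = g y) ->
  partial i f (translate k l x) = partial (i + k) g x.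
Proof.
move=> fg; rewrite /partial.
rewrite -[RHS](derive1_comp_shift _ _ l%:~R); congr (derive1 _ _).
apply/funext => t; rewrite -fg; congr f; apply/funext => j; rewrite /translate.
have [<-|ij] := eqVneq i j; first by rewrite !dfwithin subrK.
by rewrite !dfwithout//; apply: contra ij => /eqP/addIr ->.
Qed.

Lemma force_sum r : (forall j i, i \notin ball_seq r j -> partial i (S j) = fun=> 0) ->
  forall i, force i = fun x => \sum_(j <- ball_seq r i) partial i (S j) x.
Proof.
move=> out i; apply/funext => x; rewrite (fsbig_seq _ _ (ball_seq_uniq r i)).
apply/esym/fsbig_widen => // j [_ /= jr]; rewrite out//.
by move/negP: jr; rewrite !mem_ball_seq -opprB norm1N.
Qed.

Lemma force_continuous i : continuous (force i).
Proof.
have [r _ hr] := cond_A_radius; rewrite (force_sum (r := r)); last by move=> j; have [] := hr j.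
by apply: continuous_sum => j; have [[_ h] _ _ _] := hr j; exact: h.
Qed.

Lemma force_translate i k l x : force i (translate k l x) = force (i + k) x.
Proof.
have [r _ hr] := cond_A_radius.
have out j := let: And4 _ _ _ h := hr j in h.
rewrite !(force_sum out).
rewrite [in RHS]ball_seq_shift [in RHS]big_map; apply: eq_bigr => j _; apply: partial_translate.
by move=> y; exact: S_B.
Qed.

Section Band.
Variable omega : 'rV[R]_d.
Local Notation dotp := (dotp omega).

(** Configurations at bounded distance from the linear one of phase [t]. The
    functions [S j] are not globally Lipschitz; their derivatives are only
    bounded on such bands, where translations reduce everything to a compact
    product of intervals. *)
Definition band L t x : Prop := forall k, `|x k - dotp k - t| <= L.

Lemma band_box L t x : band L t x <->
  box (fun k => dotp k + t - L) (fun k => dotp k + t + L) x.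
Proof.
split=> h k; have := h k; rewrite ?ler_norml => /andP[? ?]; apply/andP; split; lra.
Qed.

Lemma band_translate L t x i : band L t x ->
  band (L + 1) 0 (translate i (- Num.floor (t + dotp i)) x).
Proof.
move=> hx k; have := hx (k + i); rewrite /translate dotpD intrN.
have := floor_le (t + dotp i); have := floorD1_gt (t + dotp i); rewrite intrD.
by rewrite !ler_norml => ? ? /andP[? ?]; apply/andP; split; lra.
Qed.

Lemma partial_translate_back i j k l x :
  partial k (partial i (S j)) x =
  partial (k - i) (partial 0 (S (j - i))) (translate i l x).
Proof.
rewrite -[in LHS](subrK i k).
apply/esym/partial_translate => y; rewrite -[in RHS](add0r i).
by apply: partial_translate => z; rewrite S_B subrK.
Qed.

Lemma force_bounded L : 0 <= L ->
  exists2 K, 0 <= K & forall t i x, band L t x -> `|force i x| <= K.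
Proof.
move=> L0; have [|K hK] := continuous_box_bounded (f := force 0)
    (lo := fun k => dotp k + 0 - (L + 1)) (hi := fun k => dotp k + 0 + (L + 1)) _ (@force_continuous 0).
  by move=> k; lra.
exists (Num.max 0 K); first by rewrite le_max lexx.
move=> t i x hx; rewrite -[i]add0r -(force_translate 0 i (- Num.floor (t + dotp i))).
by rewrite le_max hK ?orbT//; apply/band_box/band_translate.
Qed.

(** The signs in [cond_C S] are used only through this lemma: the change of
    the force between two configurations of a band is a linear combination of
    their differences, with bounded coefficients that are nonpositive off the
    diagonal and negative between nearest neighbours. *)
Lemma force_mean_value L : 0 <= L ->
  exists (n : nat) (A : R), [/\ (0 < n)%N, 0 <= A & forall t i x y, band L t x -> band L t y ->
  exists a : 'rV[int]_d -> R,
    [/\ force i y - force i x = \sum_(k <- ball_seq n i) a k * (y k - x k),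
        forall k, k != i -> a k <= 0,
        forall k, norm1 (i - k) = 1%N -> a k < 0 &
        forall k, k \in ball_seq n i -> `|a k| <= A]].
Proof.
move=> L0; have [r r0 hr] := cond_A_radius.
exists (r + r)%N.
pose Q := [set x : conf | band (L + 1) 0 x].
have bnd j k : exists A, forall x, Q x -> `|partial k (partial 0 (S j)) x| <= A.
  have [_ /(_ 0)[_ /(_ k) cj] _ _] := hr j.
  have [|A hA] := continuous_box_bounded (lo := fun k => dotp k + 0 - (L + 1))
    (hi := fun k => dotp k + 0 + (L + 1)) _ cj; first by move=> q; lra.
  by exists A => x /band_box; exact: hA.
have [A A0 hA] := @seq_bounded R _ _
  [seq (j, k) | j <- ball_seq r 0, k <- ball_seq (r + r) (0 : 'rV[int]_d)]
  (fun jk => partial jk.2 (partial 0 (S jk.1))) Q (fun jk => bnd jk.1 jk.2).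
exists ((size (ball_seq r (0 : 'rV[int]_d)))%:R * A); split; [by rewrite addn_gt0 r0|exact: mulr_ge0|].
move=> t i x y /band_box bx /band_box bY.
have mv j : exists c : 'rV[int]_d -> R, (forall k, exists2 z, band L t z & c k = partial k (partial i (S j)) z) /\
   (j \in ball_seq r i -> partial i (S j) y - partial i (S j) x =
     \sum_(k <- ball_seq (r + r) i) c k * (y k - x k)).
  have [[_ _] hC1 dep _] := hr j.
  have [pij _] := hC1 i.
  have [jr|jr] := boolP (j \in ball_seq r i); last first.
    by exists (fun k => partial k (partial i (S j)) x); split=> // k; exists x => //; apply/band_box.
  have [|c hc E] := mean_value pij (ball_seq_uniq (r + r) i) bx bY.
    move=> x' y' xy; rewrite /partial xy; last by rewrite mem_ball_seq subrr /norm1 big1// => a _; rewrite mxE.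
    congr (derive1 _ _); apply/funext => s; apply: dep => k kr.
    have [<-|ik] := eqVneq i k; first by rewrite !dfwithin.
    rewrite !dfwithout//; apply: xy; move: kr jr; rewrite !mem_ball_seq => kr jr.
    by rewrite -(subrK j k) -addrA (leq_trans (norm1D _ _))// leq_add.
  exists c; split=> // k; have [z /band_box bz ->] := hc k; by exists z.
have {}mv := fun j => cid (mv j).
pose c j := sval (mv j).
have cP j k : exists2 z, band L t z & c j k = partial k (partial i (S j)) z.
  by have [h _] := svalP (mv j); exact: h.
exists (fun k => \sum_(j <- ball_seq r i) c j k); split.
- rewrite (force_sum (r := r)); last by move=> j; have [] := hr j.
  under [RHS]eq_bigr do rewrite mulr_suml.
  rewrite exchange_big -sumrB /=; apply: eq_big_seq => j jr.
  by have [_] := svalP (mv j); exact.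
- move=> k ki; rewrite big_seq; apply: sumr_le0 => j _.
  by have [z _ ->] := cP j k; apply: S_C.1.
- move=> k ik.
  have kr : k \in ball_seq r i by rewrite mem_ball_seq -opprB norm1N ik.
  rewrite (big_rem k)//= -[ltRHS]addr0; apply: ltr_leD.
    have [z _ ->] := cP k k; apply: S_C.2; by rewrite -opprB norm1N.
  apply: sumr_le0 => j _; have [z _ ->] := cP j k; apply: S_C.1.
  by apply/eqP => ki; move: ik; rewrite ki subrr /norm1 big1// => a _; rewrite mxE.
- move=> k kr; apply: le_trans (ler_norm_sum _ _ _) _.
  rewrite -(size_ball_seq r i); apply: ler_sum_size => j jr.
  have [z bz ->] := cP j k.
  rewrite (partial_translate_back i j k (- Num.floor (t + dotp i))).
  apply: (hA (j - i, k - i)); last exact: band_translate.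
  apply/allpairsP; exists (j - i, k - i).
  by split=> //=; rewrite mem_ball_seq subr0 -mem_ball_seq.
Qed.

End Band.

End Force.

(** * Constants of the potential *)

Section PeriodicDerivative.
Context {R : realType}.

Lemma derive1_periodic (f : R -> R) (l : int) :
  (forall t, f (t + 1) = f t) -> forall t, derive1 f (t + l%:~R) = derive1 f t.
Proof.
move=> f1 t; have fn n s : f (s + n%:R) = f s.
  by elim: n s => [|n IHn] s; rewrite ?addr0// -addn1 natrD addrA f1.
have fl s : f (s - l%:~R) = f s.
  by case: l => n; [rewrite -(fn n) subrK|rewrite NegzE intrN opprK fn].
rewrite -(derive1_comp_shift f t l%:~R); congr (derive1 _ _).
by apply/funext => s; rewrite fl.
Qed.

End PeriodicDerivative.

Section Potential.
Context {R : realType} {N : nat}.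
Variables (V V1 V2 : R -> R) (m : 'I_N -> R).
Hypothesis dV : forall t : R, is_derive t (1 : R) V (V1 t).
Hypothesis dV1 : forall t : R, is_derive t (1 : R) V1 (V2 t).
Hypothesis cV2 : continuous V2.
Hypothesis V1_shift : forall t (l : int), V1 (t + l%:~R) = V1 t.
Hypothesis V2_shift : forall t (l : int), V2 (t + l%:~R) = V2 t.
Hypothesis V_Morse : forall t, V1 t = 0 -> V2 t != 0.
Hypothesis m_min : forall a, local_minimum V (m a).
Hypothesis m_distinct : forall a b, a != b -> m a - m b \isn't a Num.int.
Hypothesis m_all : forall x, local_minimum V x -> exists a, x - m a \is a Num.int.
Implicit Types (r s t : R).

Lemma is_derive_continuous (f g : R -> R) :
  (forall t : R, is_derive t (1 : R) f (g t)) -> continuous f.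
Proof. by move=> fg t; apply/differentiable_continuous/derivable1_diffP; have [] := fg t. Qed.

Let cV1 : continuous V1 := is_derive_continuous dV1.

Lemma V1_MVT s t : exists2 q, Num.min s t <= q <= Num.max s t & V1 t - V1 s = V2 q * (t - s).
Proof.
have cV := continuous_subspaceT cV1.
have [st|/ltW ts] := leP s t.
  have [q] := MVT_segment st (fun q _ => dV1 q) (cV _).
  by rewrite in_itv/=; exists q.
have [q] := MVT_segment ts (fun q _ => dV1 q) (cV _).
by rewrite in_itv/= => ? E; exists q => //; rewrite -[LHS]opprB E; ring.
Qed.

Lemma local_minimum_V1 t : local_minimum V t -> V1 t = 0.
Proof.
move=> /nbhs_ballP[e /= e0 he].
have : is_derive (t : R) (1 : R) V 0.
  apply: (@derive1_at_min R V (t - e) (t + e) t).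
  - lra.
  - by move=> s _; have [] := dV s.
  - by rewrite in_itv/=; apply/andP; split; lra.
  - move=> s; rewrite in_itv/= => /andP[? ?]; apply: he.
    by rewrite /ball/= ltr_norml; apply/andP; split; lra.
by case=> _ <-; have [_ ->] := dV t.
Qed.

Lemma V_MVT s t : s <= t -> exists2 q, s <= q <= t & V t - V s = V1 q * (t - s).
Proof.
have cV := is_derive_continuous dV.
move=> st; have [q] := MVT_segment st (fun q _ => dV q) (continuous_subspaceT cV).
by rewrite in_itv/=; exists q.
Qed.

Lemma V2_near t e : 0 < e -> exists2 q, 0 < q & forall s, `|s - t| <= q -> `|V2 t - V2 s| < e.
Proof.
move=> e0; have /cvgrPdist_lt/(_ e e0)/nbhs_ballP[q /= q0 hq] := @cV2 t.
exists (q / 2); first lra.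
by move=> s st; apply: hq; rewrite /ball/= distrC; apply: le_lt_trans st _; lra.
Qed.

Lemma critical_local_minimum t : V1 t = 0 -> 0 < V2 t -> local_minimum V t.
Proof.
move=> V1t V2t; have [q q0 hq] := V2_near t V2t.
apply/nbhs_ballP; exists q => //= s; rewrite /ball/= distrC => /ltW st.
have V2pos z : `|z - t| <= q -> 0 < V2 z.
  by move=> /hq; rewrite ltr_norml => /andP[_]; lra.
move: st; rewrite ler_norml => /andP[st1 st2].
have [ts|/ltW ts] := leP t s.
  have [z /andP[z1 z2] E] := V_MVT ts; have [y + E'] := V1_MVT t z.
  rewrite min_l// max_r// => /andP[y1 y2]; rewrite -subr_ge0 E mulr_ge0 ?subr_ge0//.
  have -> : V1 z = V2 y * (z - t) by rewrite -E' V1t subr0.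
  rewrite mulr_ge0 ?subr_ge0// ltW// V2pos//.
  by rewrite ler_norml; apply/andP; split; lra.
have [z /andP[z1 z2] E] := V_MVT ts; have [y + E'] := V1_MVT z t.
rewrite min_l// max_r// => /andP[y1 y2].
have : 0 <= V1 t - V1 z.
  rewrite E' mulr_ge0 ?subr_ge0// ltW// V2pos//.
  by rewrite ler_norml; apply/andP; split; lra.
rewrite V1t sub0r => V1z; rewrite -subr_ge0 -opprB E -mulNr mulr_ge0 ?subr_ge0//.
Qed.

Lemma local_minimum_V2 t : local_minimum V t -> 0 < V2 t.
Proof.
move=> mt; have V1t := local_minimum_V1 mt.
have V2t : V2 t != 0 by exact: V_Morse V1t.
rewrite lt_def V2t /= leNgt; apply/negP => V2neg.
have [|q q0 hq] := V2_near t (_ : 0 < - V2 t); first lra.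
move: mt => /nbhs_ballP[e /= e0 he].
pose h := Num.min q (e / 2).
have h0 : 0 < h by rewrite lt_min q0; lra.
have hle : h <= q /\ h <= e / 2 by rewrite !ge_min !lexx orbT.
have := he (t + h); rewrite /ball/= opprD addNKr normrN gtr0_norm// => /(_ ltac:(lra)).
apply/negP; rewrite -ltNge.
have V1neg s : t < s <= t + h -> V1 s < 0.
  move=> /andP[s1 s2]; have [y + E'] := V1_MVT t s.
  rewrite min_l ?max_r ?(ltW s1)// => /andP[y1 y2].
  have /hq : `|y - t| <= q by rewrite ler_norml; apply/andP; split; lra.
  rewrite ltr_norml => /andP[? _].
  have : V2 y * (s - t) < 0 by rewrite nmulr_rlt0 ?subr_gt0//; lra.
  by rewrite -E' V1t subr0.
have [w w12 E2] := @V_MVT (t + h / 2) (t + h) ltac:(lra).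
have [v v12 E3] := @V_MVT t (t + h / 2) ltac:(lra).
have n1 : V (t + h) - V (t + h / 2) < 0.
  rewrite E2 nmulr_rlt0 ?subr_gt0; [lra|apply: V1neg].
  by move: w12 => /andP[? ?]; apply/andP; split; lra.
have n2 : V (t + h / 2) - V t <= 0.
  rewrite E3; have [->|vt] := eqVneq v t; first by rewrite V1t mul0r.
  rewrite nmulr_rle0 ?subr_ge0; [lra|apply: V1neg].
  move: v12 => /andP[v1 v2]; rewrite lt_neqAle eq_sym vt v1 /=; lra.
lra.
Qed.

Lemma lattice_local_minimum r : lattice m r -> V1 r = 0 /\ 0 < V2 r.
Proof.
move=> [a /intrP[l rl]]; have -> : r = m a + l%:~R by rewrite -rl; ring.
rewrite V1_shift V2_shift; split.
  exact: local_minimum_V1.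
exact: local_minimum_V2.
Qed.

Lemma int_dist_distinct a b : a != b -> 0 < int_dist (m a - m b).
Proof.
move=> ab; rewrite lt_def int_dist_ge0 andbT; apply/eqP.
have [k ->] := int_dist_attained (m a - m b) => /eqP; rewrite normr_eq0 subr_eq0 => /eqP E.
by have := m_distinct ab; rewrite E intr_int.
Qed.

(** All the constants of the argument that depend on the potential alone. The
    fourth clause of the inner group says that where the slope is small, away
    from the minima, the curvature is definitely negative. It comes from the Morse
    condition and periodicity: the largest of [`|V1 t|], [- V2 t] and a function
    supported near the minima is positive everywhere, so it has a positive
    minimum over a period. *)
Lemma potential_constants : exists e c eta K : R,
  [/\ 0 < e <= 1, 0 < c, 0 < eta, 0 <= K &
   [/\ forall a b, a != b -> 3 * e <= int_dist (m a - m b),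
       separated m (3 * e),
       forall r t, lattice m r -> `|t - r| <= e -> c <= V2 t,
       forall t, `|V1 t| <= eta -> (exists2 r, lattice m r & `|t - r| <= e) \/ V2 t <= - c &
       forall t, V2 t <= K]].
Proof.
have V2m a : 0 < V2 (m a) by exact: local_minimum_V2.
have near_min a : \forall e \near 0^'+, forall t, `|t - m a| <= e -> V2 (m a) / 2 <= V2 t.
  have [|q q0 hq] := V2_near (m a) (_ : 0 < V2 (m a) / 2); first by have := V2m a; lra.
  near=> e => t te; have /hq : `|t - m a| <= q.
    by apply: le_trans te _; near: e; exact: nbhs_right_le.
  by rewrite ltr_norml => /andP[_]; lra.
have near_dist a : \forall e \near 0^'+, forall b, a != b -> 3 * e <= int_dist (m a - m b).
  apply: filter_forall => b; have [->|ab] := eqVneq a b; first by near=> e.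
  have d0 := int_dist_distinct ab.
  near=> e => _; have : e <= int_dist (m a - m b) / 3.
    by near: e; apply: nbhs_right_le; lra.
  lra.
have [e [/andP[e0 e1] he hd]] : exists e : R, [/\ 0 < e <= 1 / 3,
    forall a t, `|t - m a| <= e -> V2 (m a) / 2 <= V2 t &
    forall a b, a != b -> 3 * e <= int_dist (m a - m b)].
  near (0 : R)^'+ => e; exists e; split.
  - apply/andP; split; near: e; [exact: nbhs_right_gt|apply: nbhs_right_le; lra].
  - by near: e; apply: filter_forall => a; exact: near_min.
  - by near: e; apply: filter_forall => a; exact: near_dist.
have [c1 [c10 hc1]] : exists c1 : R, 0 < c1 /\ forall a, c1 <= V2 (m a) / 2.
  near (0 : R)^'+ => c1; exists c1; split; first by near: c1; exact: nbhs_right_gt.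
  near: c1; apply: filter_forall => a; apply: nbhs_right_le; have := V2m a; lra.
have sep : separated m (3 * e).
  move=> r s [a /intrP[k rk]] [b /intrP[l sl]] rs.
  have [ab|ab] := eqVneq a b.
    rewrite -{}ab in sl; have : `|(k - l)%:~R : R| < 1.
      by rewrite intrB -rk -sl; apply: lt_le_trans (_ : 3 * e <= 1); [congr (_ < _) : rs; congr (`|_|); ring|lra].
    rewrite -intr_norm -[1]/(1%:~R) ltr_int => kl.
    have {}kl : k = l by lia.
    by move: rk; rewrite kl -sl => /addIr.
  have := int_dist_le (m a - m b) (l - k); have := hd _ _ ab.
  have -> : m a - m b - (l - k)%:~R = r - s by rewrite intrB -rk -sl; ring.
  lra.
pose B t : R := \sum_a Num.max 0 (e - int_dist (t - m a)).
pose H t := Num.max `|V1 t| (Num.max (- V2 t) (B t)).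
have B_ge0 t : 0 <= B t by apply: sumr_ge0 => a _; rewrite le_max lexx.
have H0 t : 0 < H t.
  rewrite !lt_max normr_gt0; have [V1t|//] := eqVneq (V1 t) 0; rewrite /= oppr_gt0.
  have [//|V2t] := ltP (V2 t) 0; rewrite /=.
  have V2t0 : V2 t != 0 by exact: V_Morse V1t.
  have /m_all[a /intrP[k ta]] : local_minimum V t.
    by apply: critical_local_minimum => //; rewrite lt_def V2t0.
  rewrite /B (bigD1 a)//=; apply: ltr_wpDr.
    by apply: sumr_ge0 => b _; rewrite le_max lexx.
  rewrite lt_max; apply/orP; right.
  have := int_dist_le (t - m a) k; rewrite ta subrr normr0; lra.
have cB : continuous B.
  apply: (@continuous_sum R R _ (index_enum 'I_N) (fun a t => Num.max 0 (e - int_dist (t - m a)))) => a t.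
  apply: (@continuous_max R R (fun=> 0) (fun t => e - int_dist (t - m a)) t); first exact: cvg_cst.
  apply: cvgB; first exact: cvg_cst.
  apply: (@continuous_comp _ _ _ (fun t => t - m a) int_dist); last exact: int_dist_continuous.
  by apply: cvgB; [exact: cvg_id|exact: cvg_cst].
have cH : continuous H.
  move=> t; apply: (@continuous_max R R (fun t => `|V1 t|) (fun t => Num.max (- V2 t) (B t)) t).
    by apply: (@continuous_comp _ _ _ V1 Num.norm); [exact: cV1|exact: norm_continuous].
  apply: (@continuous_max R R (fun t => - V2 t) B t); last exact: cB.
  by apply: cvgN; exact: cV2.
have fract t : 0 <= t - (Num.floor t)%:~R <= 1.
  have := floor_le t; have := floorD1_gt t; rewrite intrD => ? ?.
  by apply/andP; split; lra.
have Hshift t (l : int) : H (t + l%:~R) = H t.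
  rewrite /H V1_shift V2_shift; congr (Num.max _ (Num.max _ _)).
  by apply: eq_bigr => a _; rewrite addrAC int_dist_shift.
have [q _ hq] := EVT_min ler01 (continuous_subspaceT cH : {within `[0, 1], continuous H}).
have Hq t : H q <= H t.
  by rewrite -(subrK (Num.floor t)%:~R t) Hshift; apply: hq; rewrite in_itv/= fract.
have [p _ hp] := EVT_max ler01 (continuous_subspaceT cV2 : {within `[0, 1], continuous V2}).
have c0 := H0 q; set c0' := H q in c0 Hq.
exists e, (Num.min c1 c0'), (c0' / 2), (Num.max 0 (V2 p)); split.
- by rewrite e0 /=; lra.
- by rewrite lt_min c10.
- lra.
- by rewrite le_max lexx.
split => //.
- move=> r t [a /intrP[l rl]] tr.
  have Er : r = m a + l%:~R by rewrite -rl; ring.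
  rewrite ge_min -(V2_shift t (- l)); apply/orP; left.
  apply: le_trans (hc1 a) _; apply: he.
  by rewrite intrN; congr (_ <= _) : tr; congr (`|_|); rewrite Er; ring.
- move=> t V1t; have := Hq t; rewrite /H !le_max => /or3P[h|h|h].
  + lra.
  + by right; rewrite lerNr ge_min h orbT.
  + left; have /existsP[a ha] : [exists a, int_dist (t - m a) < e].
      apply: contraT; rewrite negb_exists => /forallP hn.
      have : B t = 0 by rewrite /B big1// => a _; rewrite max_l// subr_le0 leNgt.
      by move=> B0; move: h; rewrite B0; lra.
    have [k dk] := int_dist_attained (t - m a).
    exists (m a + k%:~R); first by exists a; rewrite addrAC subrr add0r intr_int.
    by rewrite opprD addrA -dk ltW.
- move=> t; rewrite le_max -(subrK (Num.floor t)%:~R t) V2_shift hp ?orbT//.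
  by rewrite in_itv/= fract.
Unshelve. all: by end_near. Qed.

End Potential.

(** * Solutions coded by sequences of minima *)

Lemma filter_all_seq {T : Type} {I : eqType} (F : set_system T) (FF : Filter F)
    (r : seq I) (P : I -> T -> Prop) : (forall i, \forall t \near F, P i t) ->
  \forall t \near F, forall i, i \in r -> P i t.
Proof.
move=> FP; elim: r => [|j r IHr]; first by near=> t => i; rewrite in_nil.
by apply: filterS2 (FP j) IHr => t Pj h i; rewrite inE => /predU1P[->|/h].
Unshelve. all: by end_near. Qed.

Lemma halving_le {R : realType} (M e : R) : 0 < e -> exists p, M / 2 ^+ p <= e.
Proof.
move=> e0; have cv : M * (2^-1) ^+ p @[p --> \oo] --> M * 0.
  by apply: cvgM; [exact: cvg_cst|apply: cvg_expr; rewrite ger0_norm; lra].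
have : \forall p \near \oo, M * (2^-1) ^+ p <= e by apply: cvgr_le cv _ _; lra.
by move=> /filter_ex[p hp]; exists p; rewrite -exprVn.
Qed.

Lemma row_continuous {R : realType} {N : nat} {T : topologicalType} (h : 'I_N -> T -> R) :
  (forall a, continuous (h a)) -> continuous (fun t => \row_a h a t).
Proof.
move=> ch t U [P hP sPU]; apply: (@filterS _ (nbhs t) _ _ _ (fun s => sPU _)).
have : \forall s \near t, forall a, P ord0 a (h a s).
  by apply: filter_forall => a; apply: ch; have := hP ord0 a; rewrite mxE.
by apply: filterS => s hs i a; rewrite ord1 mxE.
Qed.

(** On a space with coordinates in a row it suffices to test continuity on
    sequences, which is what the dominated convergence theorem is about. *)
Lemma row_seq_continuous {R : realType} {N : nat} {T : topologicalType}
    (Q : set 'rV[R]_N) (v : T -> 'rV[R]_N) (h : 'rV[R]_N -> R) :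
  (forall t, Q (v t)) -> (forall a, continuous (fun t => v t ord0 a)) ->
  (forall (p_ : nat -> 'rV[R]_N) p, (forall j, Q (p_ j)) -> Q p ->
     (forall a, p_ j ord0 a @[j --> \oo] --> p ord0 a) -> h (p_ j) @[j --> \oo] --> h p) ->
  continuous (h \o v).
Proof.
move=> Qv cv hseq t; apply/cvgrPdist_lt => e e0; apply: contrapT => nh.
have step (j : nat) : {s : T | (forall a, `|v s ord0 a - v t ord0 a| < j.+1%:R^-1) /\
    e <= `|h (v t) - h (v s)|}.
  apply: cid; apply: contrapT => nq; apply: nh.
  have : \forall s \near t, forall a, `|v s ord0 a - v t ord0 a| < j.+1%:R^-1.
    apply: filter_forall => a; have /cvgrPdist_lt/(_ j.+1%:R^-1) := cv a t.
    rewrite invr_gt0 => /(_ (ltr0Sn _ _)).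
    by apply: filterS => s; rewrite distrC.
  apply: filterS => s hs; rewrite ltNge; apply/negP => he; apply: nq.
  by exists s.
have hv_cvg : h (v (sval (step j))) @[j --> \oo] --> h (v t).
  apply: hseq => [j||a]; [exact: Qv|exact: Qv|].
  apply/cvgrPdist_lt => e' e'0; near=> j.
  have [/(_ a) + _] := svalP (step j); rewrite distrC => hj; apply: lt_trans hj _.
  by near: j; exact: near_infty_natSinv_lt (PosNum e'0).
have /cvgrPdist_lt/(_ e e0) := hv_cvg => /filter_ex[j].
by have [_ +] := svalP (step j); rewrite leNgt => /negP.
Unshelve. all: by end_near. Qed.

Section Solutions.
Context {R : realType} {d N : nat}.
Local Notation conf := (config R d).
Variables (V1 V2 : R -> R) (m : 'I_N -> R) (S : 'rV[int]_d -> conf -> R).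
Variables (omega : 'rV[R]_d) (del c eta K L A B eps : R) (n : nat).
Local Notation dotp := (dotp omega).
Local Notation force := (force S).
Local Notation band := (band omega L).
Local Notation lattice := (lattice m).
Local Notation size0 := (size (ball_seq n (0 : 'rV[int]_d))).
Implicit Types (i j k : 'rV[int]_d) (l : int) (x y z : conf) (r s t : R).

Hypothesis S_A : cond_A S.
Hypothesis S_B : cond_B S.
Hypothesis dV1 : forall t : R, is_derive t (1 : R) V1 (V2 t).
Hypothesis cV2 : continuous V2.
Hypothesis V1_shift : forall t (l : int), V1 (t + l%:~R) = V1 t.
Hypothesis V1_lattice : forall r, lattice r -> V1 r = 0.
Hypothesis del_itv : 0 < del <= 1.
Hypothesis c_gt0 : 0 < c.
Hypothesis K_ge0 : 0 <= K.
Hypothesis lattice_separated : separated m (3 * del).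
Hypothesis well : forall r t, lattice r -> `|t - r| <= del -> c <= V2 t.
Hypothesis gap : forall t, `|V1 t| <= eta ->
  (exists2 r, lattice r & `|t - r| <= del) \/ V2 t <= - c.
Hypothesis V2_le : forall t, V2 t <= K.
Hypothesis n_gt0 : (0 < n)%N.
Hypothesis A_ge0 : 0 <= A.
Hypothesis force_diff : forall t i x y, band t x -> band t y ->
  exists a : 'rV[int]_d -> R,
    [/\ force i y - force i x = \sum_(k <- ball_seq n i) a k * (y k - x k),
        forall k, k != i -> a k <= 0,
        forall k, norm1 (i - k) = 1%N -> a k < 0 &
        forall k, k \in ball_seq n i -> `|a k| <= A].
Hypothesis force_bound : forall t i x, band t x -> `|force i x| <= B.
Hypothesis eps_gt0 : 0 < eps.
Hypothesis eps_eta : eps * B <= eta.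
Hypothesis eps_well : eps * B <= c * del.
Hypothesis eps_contract : eps * (size0%:R * A) <= c / 2.

Let del_gt0 : 0 < del. Proof. by case/andP: del_itv. Qed.
Let del_le1 : del <= 1. Proof. by case/andP: del_itv. Qed.

Definition residual i x : R := V1 (x i) + eps * force i x.

Definition is_solution x : Prop := forall i, residual i x = 0.

Lemma residual_translate i k l x :
  residual i (translate k l x) = residual (i + k) x.
Proof. by rewrite /residual force_translate// /translate V1_shift. Qed.

Lemma solution_translate k l x : is_solution x -> is_solution (translate k l x).
Proof. by move=> sx i; rewrite residual_translate. Qed.

Lemma residual_continuous i : continuous (residual i).
Proof.
have cV1 := is_derive_continuous dV1.
move=> x; apply: (@cvgD _ R _ (nbhs x) _ (fun y : conf => V1 (y i)) (fun y => eps * force i y)).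
  apply: (@continuous_comp _ _ _ (fun y : conf => y i) V1); last exact: cV1.
  exact: ptws_proj_continuous.
apply: (@cvgM _ _ (nbhs x) _ (fun=> eps) (force i)); first exact: cvg_cst.
exact: force_continuous.
Qed.

Lemma closed_solutions : closed [set x | is_solution x].
Proof.
rewrite [X in closed X](_ : _ = \bigcap_i (residual i @^-1` [set 0])).
  apply: closed_bigI => i _; apply: preimage_closed; last exact: closed_eq.
  by move=> x _; exact: residual_continuous.
by apply/seteqP; split=> [x h i _|x h i]; exact: h.
Qed.

Lemma V1_mean_value s t : exists2 q, Num.min s t <= q <= Num.max s t &
  V1 t - V1 s = V2 q * (t - s).
Proof. exact: V1_MVT dV1 s t. Qed.

Lemma mem_ball_seq_center i : i \in ball_seq n i.
Proof. by rewrite mem_ball_seq subrr /norm1 big1// => a _; rewrite mxE. Qed.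

(** In an increasing pair only the diagonal coefficient can contribute
    positively to the difference of the forces. *)
Lemma sum_offdiag_le i (a : 'rV[int]_d -> R) x y : conf_le x y ->
  (forall k, k != i -> a k <= 0) -> (forall k, k \in ball_seq n i -> `|a k| <= A) ->
  \sum_(k <- ball_seq n i) a k * (y k - x k) <= A * (y i - x i).
Proof.
move=> xy a_le a_bd; rewrite (big_rem i) ?mem_ball_seq_center//= -[leRHS]addr0.
apply: lerD.
  apply: ler_wpM2r; first by rewrite subr_ge0.
  by apply: le_trans (ler_norm _) (a_bd _ (mem_ball_seq_center i)).
rewrite big_seq; apply: sumr_le0 => k; rewrite mem_rem_uniq ?ball_seq_uniq// inE => /andP[ki _].
by apply: mulr_le0_ge0; rewrite ?a_le ?subr_ge0.
Qed.

Definition relax x : conf := fun i => x i - (K + eps * A + 1)^-1 * residual i x.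

Let relax_gt0 : 0 < K + eps * A + 1.
Proof. by have := mulr_ge0 (ltW eps_gt0) A_ge0; have := K_ge0; lra. Qed.

(** A gradient step short enough to preserve the order: the diagonal derivative
    of the residual is at most [K + eps * A] and the others are nonpositive. *)
Lemma relax_le t x y : band t x -> band t y -> conf_le x y ->
  conf_le (relax x) (relax y).
Proof.
move=> bx bY xy i; have [a [E a_le _ a_bd]] := force_diff i bx bY.
have [q _ Eq] := V1_mean_value (x i) (y i).
have xyi : 0 <= y i - x i by rewrite subr_ge0.
have : residual i y - residual i x <= (K + eps * A + 1) * (y i - x i).
  rewrite /residual opprD addrACA -mulrBr E Eq.
  have := ler_wpM2l (ltW eps_gt0) (sum_offdiag_le xy a_le a_bd).
  have := ler_wpM2r xyi (V2_le q).
  by rewrite !mulrDl mul1r -mulrA; lra.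
rewrite -ler_pdivrMl// /relax mulrBr; lra.
Qed.

(** A sequence of minima of [V] coding a solution. The band around it leaves
    room for the solution itself. *)
Definition symbol t y : Prop := (forall k, lattice (y k)) /\
  forall k, `|y k - dotp k - t| <= L - 1.

Definition tube y x : Prop := forall k, `|x k - y k| <= del.

Lemma tube_band t y x : symbol t y -> tube y x -> band t x.
Proof.
move=> [_ bY] yx k; have := bY k; have := yx k; rewrite !ler_norml.
by have := del_le1 => ? /andP[? ?] /andP[? ?]; apply/andP; split; lra.
Qed.

Definition floor_conf y : conf := fun k => y k - del.
Definition ceil_conf y : conf := fun k => y k + del.

Lemma tube_le y x : tube y x <-> conf_le (floor_conf y) x /\ conf_le x (ceil_conf y).
Proof.
split=> [h|[h1 h2] k].
  by split=> k; have := h k; rewrite ler_norml /floor_conf /ceil_conf => /andP[? ?]; lra.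
have := h1 k; have := h2 k; rewrite ler_norml /floor_conf /ceil_conf => ? ?.
by apply/andP; split; lra.
Qed.

Lemma tube_floor y : tube y (floor_conf y).
Proof. by move=> k; rewrite /floor_conf addrAC subrr add0r normrN gtr0_norm. Qed.

Lemma tube_ceil y : tube y (ceil_conf y).
Proof. by move=> k; rewrite /ceil_conf addrAC subrr add0r gtr0_norm. Qed.

Lemma well_slope r s : lattice r -> `|s - r| <= del ->
  exists2 q, c <= q & V1 s = q * (s - r).
Proof.
move=> lr sr; have [q /andP[q1 q2] E] := V1_mean_value r s.
exists (V2 q); last by rewrite -E (V1_lattice lr) subr0.
apply: (well lr); move: sr q1 q2; rewrite !ler_norml.
have [rs|/ltW rs] := leP r s => /andP[? ?] ? ?; apply/andP; split; lra.
Qed.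

Let force_le t i x : band t x -> - (c * del) <= eps * force i x <= c * del.
Proof.
move=> bx; rewrite -ler_norml normrM gtr0_norm//.
by apply: le_trans eps_well; rewrite ler_pM2l//; exact: force_bound bx.
Qed.

(** On the lower edge of the tube the restoring force of the well, at least
    [c * del], outweighs the interaction; likewise on the upper edge. *)
Lemma residual_floor t y i : symbol t y -> residual i (floor_conf y) <= 0.
Proof.
move=> sy; have /andP[_ h] := force_le i (tube_band sy (@tube_floor y)).
have [q qc E] := well_slope (sy.1 i) (tube_floor y i).
have -> : residual i (floor_conf y) = q * - del + eps * force i (floor_conf y).
  by rewrite /residual E /floor_conf; congr (_ * _ + _); ring.
by have := ler_wpM2r (ltW del_gt0) qc; lra.
Qed.

Lemma residual_ceil t y i : symbol t y -> 0 <= residual i (ceil_conf y).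
Proof.
move=> sy; have /andP[h _] := force_le i (tube_band sy (@tube_ceil y)).
have [q qc E] := well_slope (sy.1 i) (tube_ceil y i).
have -> : residual i (ceil_conf y) = q * del + eps * force i (ceil_conf y).
  by rewrite /residual E /ceil_conf; congr (_ * _ + _); ring.
by have := ler_wpM2r (ltW del_gt0) qc; lra.
Qed.

Definition relax_iter y p : conf := iter p relax (floor_conf y).

Lemma relax_tube t y x : symbol t y -> tube y x -> tube y (relax x).
Proof.
move=> sy yx; have bx := tube_band sy yx; move: yx => /tube_le[h1 h2]; apply/tube_le.
have inv0 : 0 <= (K + eps * A + 1)^-1 by rewrite invr_ge0; exact: ltW relax_gt0.
split.
  apply: conf_le_trans (relax_le (tube_band sy (@tube_floor y)) bx h1) => i.
  by rewrite /relax lerBrDr gerDl; apply: mulr_ge0_le0 => //; exact: residual_floor sy.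
apply: conf_le_trans (relax_le bx (tube_band sy (@tube_ceil y)) h2) _ => i.
by rewrite /relax lerBlDr lerDl; apply: mulr_ge0 => //; exact: residual_ceil sy.
Qed.

Lemma relax_iter_tube t y p : symbol t y -> tube y (relax_iter y p).
Proof. by move=> sy; elim: p => [|p]; [exact: tube_floor|exact: relax_tube sy]. Qed.

Lemma relax_iter_step t y p : symbol t y -> conf_le (relax_iter y p) (relax_iter y p.+1).
Proof.
move=> sy; have bnd q := tube_band sy (relax_iter_tube q sy).
elim: p => [|p IHp]; last exact: relax_le (bnd _) (bnd _) IHp.
by have [] := (tube_le _ _).1 (relax_iter_tube 1 sy).
Qed.

(** The limit of the monotone iteration started at the lower edge of the tube. *)
Definition coded y : conf := fun i => sup (range (fun p => relax_iter y p i)).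

Lemma relax_iter_cvg t y : symbol t y -> relax_iter y p @[p --> \oo] --> coded y.
Proof.
move=> sy; apply/ptws_cvgP => i; apply: nondecreasing_cvgn.
  by apply/nondecreasing_seqP => p; exact: relax_iter_step sy i.
exists (ceil_conf y i) => _ [p _ <-].
by have [_] := (tube_le _ _).1 (relax_iter_tube p sy); exact.
Qed.

Lemma relax_iter_cvg_at t y i : symbol t y ->
  relax_iter y p i @[p --> \oo] --> coded y i.
Proof. by move=> /relax_iter_cvg/ptws_cvgP; exact. Qed.

Lemma coded_tube t y : symbol t y -> tube y (coded y).
Proof.
move=> sy; apply/tube_le; split.
  apply: (closed_cvg _ (@closed_conf_ge R d (floor_conf y)) _ _ (relax_iter_cvg sy)).
  by apply: nearW => p; have [] := (tube_le _ _).1 (relax_iter_tube p sy).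
apply: (closed_cvg _ (@closed_conf_le R d (ceil_conf y)) _ _ (relax_iter_cvg sy)).
by apply: nearW => p; have [] := (tube_le _ _).1 (relax_iter_tube p sy).
Qed.

Lemma coded_band t y : symbol t y -> band t (coded y).
Proof. by move=> sy; exact: tube_band (coded_tube sy). Qed.

Lemma coded_solution t y : symbol t y -> is_solution (coded y).
Proof.
move=> sy i; have cvgX := relax_iter_cvg sy.
have resE p : residual i (relax_iter y p) =
    (K + eps * A + 1) * (relax_iter y p i - relax_iter y p.+1 i).
  have -> : relax_iter y p.+1 i = relax (relax_iter y p) i by [].
  by rewrite /relax subKr mulVKf// gt_eqF.
have res_cvg : residual i (relax_iter y p) @[p --> \oo] --> residual i (coded y).
  exact: (cvg_comp _ _ cvgX (@residual_continuous i (coded y))).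
have cvgi := relax_iter_cvg_at (i := i) sy.
have cvgi1 : relax_iter y p.+1 i @[p --> \oo] --> coded y i.
  by rewrite (cvg_shiftS (fun p => relax_iter y p i)).
have : residual i (relax_iter y p) @[p --> \oo] --> (K + eps * A + 1) * (coded y i - coded y i).
  under eq_fun do rewrite resE.
  by apply: cvgM; [exact: cvg_cst|exact: cvgB].
rewrite subrr mulr0; exact: cvg_unique res_cvg.
Qed.

Lemma coded_le t y z : symbol t y -> symbol t z -> conf_le y z ->
  conf_le (coded y) (coded z).
Proof.
move=> sy sz yz i.
have iter_le p : conf_le (relax_iter y p) (relax_iter z p).
  elim: p => [|p IHp]; first by move=> k; rewrite /relax_iter/= /floor_conf lerD2r.
  exact: relax_le (tube_band sy (relax_iter_tube p sy)) (tube_band sz (relax_iter_tube p sz)) IHp.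
have cy := relax_iter_cvg_at (i := i) sy.
have cz := relax_iter_cvg_at (i := i) sz.
apply: (ler_cvg_to cy cz); apply: nearW => p; exact: iter_le.
Qed.

Definition same_well x y k : Prop :=
  exists r, [/\ lattice r, `|x k - r| <= del & `|y k - r| <= del].

(** At a site where two solutions sit in the same well their distance is at most
    half of its largest value in the neighbourhood, so agreement of the codes
    on a large ball makes the solutions close at its centre. *)
Lemma solution_decay t x y i p : is_solution x -> is_solution y ->
  band t x -> band t y ->
  (forall k, k \in ball_seq (p * n) i -> same_well x y k) ->
  `|y i - x i| <= 2 * L / 2 ^+ p.
Proof.
move=> sx sy bx bY; elim: p i => [|p IHp] i h.
  rewrite expr0 divr1; have := bx i; have := bY i; rewrite !ler_norml.
  by move=> /andP[? ?] /andP[? ?]; apply/andP; split; lra.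
have [r [lr xr yr]] : same_well x y i by apply: h; rewrite mem_ball_seq subrr /norm1 big1// => a _; rewrite mxE.
have IH k : k \in ball_seq n i -> `|y k - x k| <= 2 * L / 2 ^+ p.
  rewrite mem_ball_seq => kn; apply: IHp => j; rewrite !mem_ball_seq => jp.
  apply: h; rewrite mem_ball_seq -(subrK k j) -addrA (leq_trans (norm1D _ _))//.
  by rewrite mulSn addnC leq_add.
have [a [E _ _ a_bd]] := force_diff i bx bY.
have [q /andP[q1 q2] Eq] := V1_mean_value (x i) (y i).
have cq : c <= V2 q.
  apply: (well lr); move: xr yr q1 q2; rewrite !ler_norml.
  have [xy|/ltW xy] := leP (x i) (y i) => /andP[? ?] /andP[? ?] ? ?; apply/andP; split; lra.
have EE : V2 q * (y i - x i) = - (eps * \sum_(k <- ball_seq n i) a k * (y k - x k)).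
  rewrite -Eq -E; have := sx i; have := sy i; rewrite /residual mulrBr; lra.
set M := 2 * L / 2 ^+ p in IH.
have M_ge0 : 0 <= M by apply: le_trans (IH i (mem_ball_seq_center i)).
have sum_le : `|\sum_(k <- ball_seq n i) a k * (y k - x k)| <= size0%:R * (A * M).
  apply: le_trans (ler_norm_sum _ _ _) _; rewrite -(size_ball_seq n i).
  by apply: ler_sum_size => k kn; rewrite normrM; apply: ler_pM => //; [exact: a_bd|exact: IH].
have h1 : c * `|y i - x i| <= c / 2 * M.
  apply: (@le_trans _ _ (V2 q * `|y i - x i|)); first by apply: ler_wpM2r.
  have V2q0 : 0 < V2 q by apply: lt_le_trans cq.
  rewrite -{1}(gtr0_norm V2q0) -normrM EE normrN normrM gtr0_norm//.
  apply: (@le_trans _ _ (eps * (size0%:R * (A * M)))); first by rewrite ler_pM2l.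
  by have := ler_wpM2r M_ge0 eps_contract; rewrite -!mulrA.
have -> : 2 * L / 2 ^+ p.+1 = M / 2 by rewrite exprS /M; field; rewrite expf_neq0.
by rewrite -(ler_pM2l c_gt0) (le_trans h1)//; lra.
Qed.

Lemma solution_unique t x y : is_solution x -> is_solution y -> band t x -> band t y ->
  (forall k, same_well x y k) -> x = y.
Proof.
move=> sx sy bx bY h; apply/funext => i; apply/eqP; rewrite eq_sym -subr_eq0 -normr_le0.
have dec p := solution_decay sx sy bx bY (fun k (_ : k \in ball_seq (p * n) i) => h k).
apply/ler_addgt0Pl => e e0; rewrite addr0.
have [p hp] := halving_le (2 * L) e0.
exact: le_trans (dec p) hp.
Qed.

Lemma tube_same_well t y x z : symbol t y -> tube y x -> tube y z ->
  forall k, same_well x z k.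
Proof. by move=> sy yx yz k; exists (y k); split; [exact: sy.1|exact: yx|exact: yz]. Qed.

Lemma coded_unique t y x : symbol t y -> is_solution x -> tube y x -> x = coded y.
Proof.
move=> sy sx yx; apply: (solution_unique (t := t)) => //.
- exact: coded_solution sy.
- exact: tube_band yx.
- exact: coded_band.
- exact: (tube_same_well sy yx (coded_tube sy)).
Qed.

Lemma symbol_translate t y k l : symbol t y ->
  symbol (t + dotp k + l%:~R) (translate k l y).
Proof.
move=> [ly bY]; split=> i; rewrite /translate.
  have [a /intrP[q yq]] := ly (i + k); exists a.
  by rewrite addrAC rpredD ?intr_int// yq intr_int.
by have := bY (i + k); rewrite dotpD; congr (_ <= _); congr (`|_|); ring.
Qed.

(** By uniqueness, since translates of solutions are solutions. *)
Lemma coded_translate t y k l : symbol t y ->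
  coded (translate k l y) = translate k l (coded y).
Proof.
move=> sy; apply/esym/(coded_unique (symbol_translate k l sy)).
  by apply: solution_translate; exact: coded_solution sy.
move=> i; rewrite /translate opprD addrACA subrr addr0; exact: coded_tube sy _.
Qed.

(** Equality of two ordered solutions at one site makes a sum of nonpositive
    terms vanish, and the nearest-neighbour terms have nonzero coefficients. *)
Lemma ordered_solutions_eq t x y i : is_solution x -> is_solution y ->
  band t x -> band t y -> conf_le x y -> x i = y i -> x = y.
Proof.
move=> sx sy bx bY xy xyi; apply/funext; apply: (norm1_ind xyi) => {xyi}i k xyi ik.
have [a [E a_le a_lt _]] := force_diff i bx bY.
have sum0 : \sum_(k <- ball_seq n i) - (a k * (y k - x k)) = 0.
  rewrite sumrN -E; have := sx i; have := sy i; rewrite /residual xyi => h1 h2.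
  by apply/eqP; rewrite oppr_eq0; apply/eqP; apply: (mulfI (lt0r_neq0 eps_gt0)); rewrite mulrBr; lra.
have kn : k \in ball_seq n i by rewrite mem_ball_seq -opprB norm1N ik.
have term_ge0 j : 0 <= - (a j * (y j - x j)).
  have [->|ji] := eqVneq j i; first by rewrite xyi subrr mulr0 oppr0.
  by rewrite oppr_ge0; apply: mulr_le0_ge0; rewrite ?a_le ?subr_ge0.
have : - (a k * (y k - x k)) = 0.
  apply/eqP; rewrite eq_le term_ge0 andbT -sum0 (big_rem k)//= lerDl.
  by apply: sumr_ge0 => j _; exact: term_ge0.
move/eqP; rewrite oppr_eq0 mulf_eq0 (lt_eqF (a_lt _ ik))/= subr_eq0.
by move/eqP.
Qed.

(** Near a maximum the diagonal term of the linearised equation is negative and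
    the others are nonpositive, hence two ordered solutions cannot be distinct there. *)
Lemma no_maximum t x y i : is_solution x -> is_solution y ->
  band t x -> band t y -> conf_le x y ->
  (forall q, x i <= q <= y i -> V2 q < - (c / 2)) -> x = y.
Proof.
move=> sx sy bx bY xy V2neg; apply: (ordered_solutions_eq (t := t) (i := i)) => //.
have [a [E a_le _ a_bd]] := force_diff i bx bY.
have [q + Eq] := V1_mean_value (x i) (y i).
rewrite min_l// max_r// => q12; have q_lt := V2neg _ q12.
have xyi : 0 <= y i - x i by rewrite subr_ge0.
have EE : V2 q * (y i - x i) + eps * \sum_(k <- ball_seq n i) a k * (y k - x k) = 0.
  rewrite -Eq -E; have := sx i; have := sy i; rewrite /residual mulrBr; lra.
have h := ler_wpM2l (ltW eps_gt0) (sum_offdiag_le xy a_le a_bd).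
have epsA : eps * A <= c / 2.
  apply: le_trans eps_contract; rewrite ler_pM2l// ler_peMl// ler1n -(size_ball_seq n i).
  by have := mem_ball_seq_center i; case: (ball_seq n i).
have epsA' := ler_wpM2r xyi epsA.
rewrite mulrA in h; apply/eqP; rewrite -subr_eq0 -opprB oppr_eq0.
apply/eqP/le_anti; rewrite xyi andbT leNgt; apply/negP => xy0.
have : V2 q * (y i - x i) < - (c / 2) * (y i - x i) by rewrite ltr_pM2r.
rewrite mulNr; lra.
Qed.

(** Around a point of a perfect ordered set of solutions there are others that are
    comparable to it, so by the previous lemma none of its coordinates lies near
    a maximum of [V]; the equation confines them to neighbourhoods of critical
    points. *)
Lemma solution_near_lattice (G : set conf) t x i :
  G `<=` [set x | is_solution x] ->
  (forall x y, G x -> G y -> comparable x y) ->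
  (forall e, 0 < e -> exists y, [/\ G y, y <> x & `|y i - x i| < e]) ->
  (forall y, G y -> `|y i - x i| <= 1 -> band t y) ->
  G x -> exists2 r, lattice r & `|x i - r| <= del.
Proof.
move=> G_sol G_cmp G_perf G_band Gx.
have bx : band t x by apply: G_band => //; rewrite subrr normr0.
have V1x : `|V1 (x i)| <= eta.
  have -> : V1 (x i) = - (eps * force i x).
    by have := G_sol _ Gx i; rewrite /residual; lra.
  rewrite normrN normrM gtr0_norm//; apply: le_trans eps_eta.
  by rewrite ler_pM2l//; exact: force_bound bx.
have [//|V2x] := gap V1x.
have [|q q0 hq] := V2_near cV2 (x i) (_ : 0 < c / 2); first by rewrite divr_gt0.
exfalso.
have e0 : 0 < Num.min 1 q by rewrite lt_min ltr01 q0.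
have [y [Gy yx]] := G_perf _ e0; rewrite lt_min => /andP[y1 yq].
have bY : band t y by apply: G_band => //; exact: ltW.
have V2neg s : `|s - x i| <= q -> V2 s < - (c / 2).
  by move=> /hq; rewrite ltr_norml => /andP[? _]; lra.
move: yq; rewrite ltr_norml => /andP[yq1 yq2].
have [xy|xy] := G_cmp _ _ Gx Gy.
  apply: yx; apply/esym/(no_maximum (G_sol _ Gx) (G_sol _ Gy) bx bY xy (i := i)) => s /andP[s1 s2].
  by apply: V2neg; rewrite ler_norml; apply/andP; split; lra.
apply: yx; apply: (no_maximum (G_sol _ Gy) (G_sol _ Gx) bY bx xy (i := i)) => s /andP[s1 s2].
by apply: V2neg; rewrite ler_norml; apply/andP; split; lra.
Qed.


(** * Laminations of solutions and the simplex *)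

Hypothesis omega_irr : irrational_vector omega.
(* The step functions stay within [1 + spread m] of the identity; phases up to
   distance 1 apart are compared in one band, and a tube adds at most 1. Elements
   of a hull set at distance at most 2 at one site lie in one band of width 4. *)
Hypothesis L_eq : L = 4 + spread m.
Hypothesis minima_distance : forall a b, a != b -> 3 * del <= int_dist (m a - m b).
Local Notation simplex := (simplex R N).
Local Notation hull_conf := (hull_conf omega).
Local Notation hull_set := (hull_set omega).
Local Notation step_hull := (step_hull m).
Local Notation mu := (@lebesgue_measure R).
Implicit Types (p : 'rV[R]_N) (u phi : R -> R) (G : set conf).

Let spread_ge0 : 0 <= spread m.
Proof. by apply: sumr_ge0 => a _. Qed.

Lemma coded_cvg {T : Type} (F : set_system T) (FF : Filter F) (y_ : T -> conf) y t i :
  (\forall q \near F, symbol t (y_ q)) -> symbol t y ->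
  (forall k, \forall q \near F, y_ q k = y k) ->
  coded (y_ q) i @[q --> F] --> coded y i.
Proof.
move=> sy_ sy yk; apply/cvgrPdist_le => e e0.
have [p hp] := halving_le (2 * L) e0.
have yball := filter_all_seq FF (ball_seq (p * n) i) yk.
near=> q.
have sq : symbol t (y_ q) by near: q.
rewrite distrC -[leRHS]/e; apply: le_trans hp; rewrite distrC.
apply: (solution_decay (t := t)).
- exact: coded_solution sq.
- exact: coded_solution sy.
- exact: coded_band.
- exact: coded_band.
- move=> k kb; exists (y k); split; first exact: sy.1.
    have <- : y_ q k = y k by move: k kb; near: q.
    exact: coded_tube sq k.
  exact: coded_tube sy k.
Unshelve. all: by end_near. Qed.

Lemma symbol_step_hull p s t : simplex p -> `|t - s| <= 1 ->
  symbol t (hull_conf (step_hull p) s).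
Proof.
move=> hp st; split=> k; first exact: step_hull_lattice.
have := step_hull_bound m (s + dotp k) hp.
move: st; rewrite L_eq !ler_norml => /andP[? ?] /andP[? ?].
by apply/andP; split; lra.
Qed.

Lemma coded_symbol_translate p s k l : simplex p ->
  coded (hull_conf (step_hull p) (s + (dotp k + l%:~R))) =
  translate k l (coded (hull_conf (step_hull p) s)).
Proof.
move=> hp; rewrite -(coded_translate _ _ (symbol_step_hull (s := s) (t := s) hp _)).
  by rewrite translate_hull_conf//; exact: step_hull_hull_function.
by rewrite subrr normr0.
Qed.

(** The value at the origin of the coded solution of phase [s]; by equivariance
    it gives the values at all other sites. *)
Definition coded_hull p s : R := coded (hull_conf (step_hull p) s) 0.

Lemma hull_conf_coded_hull p s : simplex p ->
  hull_conf (coded_hull p) s = coded (hull_conf (step_hull p) s).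
Proof.
move=> hp; apply/funext => k; rewrite /hull_conf /coded_hull.
have := coded_symbol_translate s k 0 hp; rewrite addr0 => ->.
by rewrite /translate add0r addr0.
Qed.

Let symbol_self p s : simplex p -> symbol s (hull_conf (step_hull p) s).
Proof. by move=> hp; apply: symbol_step_hull => //; rewrite subrr normr0. Qed.

Lemma coded_hull_near p s : simplex p -> `|coded_hull p s - step_hull p s| <= del.
Proof.
move=> hp; have := coded_tube (symbol_self s hp) 0.
by rewrite /hull_conf dotp0 addr0.
Qed.

Lemma coded_hull_cvg {T : Type} (F : set_system T) (FF : Filter F) p (p_ : T -> 'rV[R]_N)
    s (s_ : T -> R) : simplex p -> (forall q, simplex (p_ q)) ->
  (\forall q \near F, `|s - s_ q| <= 1) ->
  (forall k, \forall q \near F, step_hull (p_ q) (s_ q + dotp k) = step_hull p (s + dotp k)) ->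
  coded_hull (p_ q) (s_ q) @[q --> F] --> coded_hull p s.
Proof.
move=> hp hp_ hs hk; apply: (@coded_cvg T F FF (fun q => hull_conf (step_hull (p_ q)) (s_ q)) _ s) => //.
- near=> q; apply: symbol_step_hull => //; near: q; exact: hs.
- exact: symbol_self.
Unshelve. all: by end_near. Qed.

(** The step function is left-continuous with discrete values, so on a finite
    ball of sites the code is constant just to the left of a phase; hence the
    coded solution inherits left-continuity. *)
Lemma coded_hull_left p s : simplex p -> coded_hull p t @[t --> s^'-] --> coded_hull p s.
Proof.
move=> hp; have [h_homo _ h_left] := step_hull_hull_function m hp.
have del0 := del_gt0.
apply: (@coded_hull_cvg R (s^'-) _ p (fun=> p) s id) => // [|k].
  near=> t; rewrite ger0_norm ?subr_ge0; last first.
    by near: t; apply: nbhs_left_le.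
  by rewrite lerBlDl -lerBlDr; near: t; apply: nbhs_left_ge; lra.
have [r rs hr] := h_left (s + dotp k) (3 * del) ltac:(lra).
near=> t; apply: lattice_separated; [exact: step_hull_lattice|exact: step_hull_lattice|].
have ts : t <= s by near: t; exact: nbhs_left_le.
have rt : r - dotp k <= t by near: t; apply: nbhs_left_ge; lra.
have rt' : r <= t + dotp k by lra.
have ts' : t + dotp k <= s + dotp k by lra.
have := h_homo _ _ rt'; have := h_homo _ _ ts'.
by rewrite ltr_norml => ? ?; apply/andP; split; lra.
Unshelve. all: by end_near. Qed.

Lemma coded_hull_hull_function p : simplex p -> hull_function (coded_hull p).
Proof.
move=> hp; split.
- have le1 s t : s <= t <= s + 1 -> coded_hull p s <= coded_hull p t.
    move=> /andP[st ts]; apply: (coded_le (t := s)).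
    + exact: symbol_self.
    + by apply: symbol_step_hull => //; rewrite distrC ger0_norm; lra.
    + by apply: hull_conf_le => //; exact: step_hull_hull_function.
  have leN n' s t : s <= t <= s + n'%:R -> coded_hull p s <= coded_hull p t.
    elim: n' s => [|n' IHn] s /andP[st ts].
      by have -> : t = s by apply/le_anti; rewrite st andbT; rewrite addr0 in ts.
    have [ts1|/ltW ts1] := leP t (s + 1); first by apply: le1; rewrite st.
    apply: (@le_trans _ _ (coded_hull p (s + 1))).
      by apply: le1; apply/andP; split; lra.
    by apply: IHn; rewrite ts1 -addrA [1 + _]addrC natr1.
  move=> s t st; apply: (leN (Num.truncn (t - s)).+1); rewrite st/= -lerBlDl ltW//.
  exact: truncnS_gt.
- move=> s; rewrite /coded_hull; have := coded_symbol_translate s 0 1 hp.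
  by rewrite dotp0 add0r => ->; rewrite /translate addr0.
- move=> s e e0; have /cvgrPdist_lt/(_ e e0) h := coded_hull_left (s := s) hp.
  have : \forall t \near s^'-, t < s /\ coded_hull p s - e < coded_hull p t.
    near=> t; split; first by near: t; exact: nbhs_left_lt.
    have : `|coded_hull p s - coded_hull p t| < e by near: t.
    by rewrite ltr_norml => /andP[_]; lra.
  by move=> /filter_ex[t [ts ht]]; exists t.
Unshelve. all: by end_near. Qed.

Lemma near_lattice_unique v r r' : lattice r -> lattice r' ->
  `|v - r| <= del -> `|v - r'| <= del -> r = r'.
Proof.
move=> lr lr'; rewrite !ler_norml => /andP[? ?] /andP[? ?].
apply: lattice_separated => //; have := del_gt0; rewrite ltr_norml => ?.
by apply/andP; split; lra.
Qed.

Definition in_wells x : Prop := forall k, exists2 r, lattice r & `|x k - r| <= del.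

Lemma closed_near_lattice : closed [set v | exists2 r, lattice r & `|v - r| <= del].
Proof.
rewrite (_ : mkset _ = \big[setU/set0]_(a : 'I_N) [set v | int_dist (v - m a) <= del]).
  apply: closed_bigsetU => a _; apply: (@preimage_closed _ _ (fun v => int_dist (v - m a)) [set t | t <= del]).
    move=> v _; apply: (@continuous_comp _ _ _ (fun v => v - m a) int_dist).
      by apply: cvgB; [exact: cvg_id|exact: cvg_cst].
    exact: int_dist_continuous.
  exact: closed_le.
rewrite -bigcup_seq; apply/seteqP; split=> v /=.
  move=> [r [a /intrP[l rl]] vr]; exists a => /=; first exact: mem_index_enum.
  apply: le_trans (int_dist_le _ l) _.
  by rewrite -rl; congr (_ <= _) : vr; congr (`|_|); ring.
move=> [a _ /=]; have [l ->] := int_dist_attained (v - m a) => h.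
exists (m a + l%:~R); first by exists a; rewrite addrAC subrr add0r intr_int.
by rewrite opprD addrA.
Qed.

Lemma hull_set_closed_property u (E : set conf) : closed E ->
  (forall s, E (hull_conf u s)) -> hull_set u `<=` E.
Proof.
move=> cE hE; rewrite [X in _ `<=` X](closure_id E).1//.
by apply: closureS => _ [s _ <-].
Qed.

Lemma hull_set_in_wells u : (forall s, exists2 r, lattice r & `|u s - r| <= del) ->
  hull_set u `<=` in_wells.
Proof.
move=> hu x ux k; apply: (hull_set_closed_property (E := [set x | _]) _ _ ux) => [|s].
  apply: (@preimage_closed _ _ (fun x : conf => x k)) closed_near_lattice.
  by move=> y _; exact: ptws_proj_continuous.
exact: hu.
Qed.

Lemma hull_set_band u x y k : hull_function u -> hull_set u x -> hull_set u y ->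
  `|y k - x k| <= 2 -> band (x k - dotp k) y.
Proof.
move=> hu ux uy xyk j; have [s sy] := hull_set_at_phase hu uy.
have := at_phase_bound k hu sy; have := at_phase_bound j hu sy.
move: xyk; rewrite L_eq !ler_norml => /andP[? ?] /andP[? ?] /andP[? ?].
by have := spread_ge0 => ?; apply/andP; split; lra.
Qed.

(** The elements of a hull set have different phases, but visiting the same well
    at one site puts two of them in a common band, where solutions are unique. *)
Lemma same_well_everywhere_eq u x y : hull_function u ->
  hull_set u `<=` [set z | is_solution z] -> hull_set u x -> hull_set u y ->
  (forall k, same_well x y k) -> x = y.
Proof.
move=> hu u_sol ux uy xy; apply: (solution_unique (t := x 0 - dotp 0)) => //.
- exact: u_sol.
- exact: u_sol.
- by apply: (@hull_set_band u x x 0) => //; rewrite subrr normr0 ler0n.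
- apply: (@hull_set_band u x y 0) => //; have [r [_ + +]] := xy 0.
  by have := del_le1; rewrite !ler_norml => ? /andP[? ?] /andP[? ?]; apply/andP; split; lra.
Qed.

(** No coordinate lies between two neighbouring wells, so the sets prescribing the
    well occupied at one site are open and closed. *)
Lemma hull_set_zero_dimensional u : hull_function u ->
  hull_set u `<=` [set w | is_solution w] -> hull_set u `<=` in_wells ->
  zero_dimensional (hull_set u).
Proof.
move=> hu u_sol u_wells x y xy; have del0 := del_gt0.
have ux := set_valP x; have uy := set_valP y.
have [k nk] : exists k, ~ same_well (set_val x) (set_val y) k.
  apply: contrapT => h; move/eqP: xy; apply; apply: val_inj.
  apply: (same_well_everywhere_eq hu u_sol) => // k.
  by apply: contrapT => nk; apply: h; exists k.
have [r lr xr] := u_wells _ ux k.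
pose ev (w : hull_set u) : R := set_val w k.
have ev_cont : continuous ev.
  move=> w; apply: (@continuous_comp _ _ _ (set_val : hull_set u -> conf) (fun v : conf => v k)).
    exact: initial_continuous.
  exact: ptws_proj_continuous.
have dist_cont : continuous (fun w => `|ev w - r|).
  move=> w; apply: (@continuous_comp _ _ _ ev (fun t => `|t - r|)); first exact: ev_cont.
  apply: (@continuous_comp _ _ _ (fun t => t - r) Num.norm); last exact: norm_continuous.
  by apply: cvgB; [exact: cvg_id|exact: cvg_cst].
have E : [set w | `|ev w - r| <= del] = [set w | `|ev w - r| < 2 * del].
  apply/seteqP; split=> w /= zr; first lra.
  have [r' lr' wr'] := u_wells _ (set_valP w) k.
  have zr' : `|ev w - r'| <= del := wr'.
  suff -> : r = r' by exact: zr'.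
  apply: lattice_separated => //; move: zr zr'; rewrite ltr_norml ler_norml ltr_norml.
  by move=> /andP[? ?] /andP[? ?]; apply/andP; split; lra.
exists [set w | `|ev w - r| <= del]; split => //.
- split.
    rewrite E; apply: (@open_comp _ _ (fun w => `|ev w - r|) [set t | t < 2 * del]).
      by move=> w _; exact: dist_cont.
    exact: open_lt.
  apply: (@preimage_closed _ _ (fun w => `|ev w - r|) [set t | t <= del]).
    by move=> w _; exact: dist_cont.
  exact: closed_le.
- by move=> yr; apply: nk; exists r.
Qed.

Definition coded_lamination p : set conf := hull_set (coded_hull p).

Lemma coded_lamination_solution p : simplex p ->
  coded_lamination p `<=` [set x | is_solution x].
Proof.
move=> hp; apply: hull_set_closed_property; first exact: closed_solutions.
move=> s; rewrite hull_conf_coded_hull//; exact: coded_solution (symbol_self s hp).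
Qed.

Lemma coded_lamination_in_wells p : simplex p -> coded_lamination p `<=` in_wells.
Proof.
move=> hp; apply: hull_set_in_wells => s; exists (step_hull p s).
  exact: step_hull_lattice.
exact: coded_hull_near.
Qed.

(** The jump of [step_hull p] at the phase [step_cdf m p 0] is seen, along
    the orbit, by the configurations of any two distinct phases. *)
Lemma coded_hull_injective p s t : simplex p -> s < t ->
  hull_conf (coded_hull p) s <> hull_conf (coded_hull p) t.
Proof.
move=> hp st; pose s0 := step_cdf m p 0.
have [|k [l /andP[kl1 kl2]]] := dotp_dense omega_irr (_ : s0 - t < s0 - s); first lra.
have hh := step_hull_hull_function m hp.
have le_neg : step_hull p (s + dotp k) + l%:~R <= 0.
  by rewrite -hull_shift// step_hull_le// -/s0; lra.
have pos : 0 < step_hull p (t + dotp k) + l%:~R.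
  by rewrite -hull_shift// ltNge step_hull_le// -/s0 -ltNge; lra.
move=> /(congr1 (fun x : conf => x k)); rewrite /hull_conf => E.
have : step_hull p (s + dotp k) = step_hull p (t + dotp k).
  apply: (near_lattice_unique (v := coded_hull p (s + dotp k))).
  - exact: step_hull_lattice.
  - exact: step_hull_lattice.
  - exact: coded_hull_near.
  - by rewrite E; exact: coded_hull_near.
by move=> E'; rewrite E' in le_neg; lra.
Qed.

(** The configurations [hull_conf (coded_hull p) s] are distinct for distinct
    phases and left-continuous in the phase, so none of them is isolated; any
    other point of the closure is a limit of them. *)
Lemma coded_lamination_perfect p : simplex p -> perfect_set (coded_lamination p).
Proof.
move=> hp; have hu := coded_hull_hull_function hp.
split; first exact: closed_closure.
apply/seteqP; split.
  move=> x /subset_limit_point; rewrite -(closure_id (coded_lamination p)).1//.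
  exact: closed_closure.
move=> x px U Ux; have [[t _ xt]|nx] := EM (range (hull_conf (coded_hull p)) x); last first.
  have [y [ry Uy]] := px _ Ux; exists y; split => //; first by apply/eqP => yx; apply: nx; rewrite -yx.
  exact: subset_closure.
rewrite -{x}xt in px Ux *.
have cv : hull_conf (coded_hull p) s @[s --> t^'-] --> hull_conf (coded_hull p) t.
  apply/ptws_cvgP => k; apply/cvgrPdist_lt => e e0.
  have [u_homo _ u_left] := hu; have [r rt ur] := u_left (t + dotp k) e e0.
  near=> s; have st : s + dotp k <= t + dotp k by rewrite lerD2r; near: s; exact: nbhs_left_le.
  have rs : r <= s + dotp k by rewrite -lerBlDr; near: s; apply: nbhs_left_ge; lra.
  have := u_homo _ _ st; have := u_homo _ _ rs; rewrite /hull_conf ltr_norml => ? ?.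
  by apply/andP; split; lra.
have : \forall s \near t^'-, s < t /\ U (hull_conf (coded_hull p) s).
  by near=> s; split; [near: s; exact: nbhs_left_lt|near: s; exact: (cv _ Ux)].
move=> /filter_ex[s [st Us]]; exists (hull_conf (coded_hull p) s); split => //.
  exact/eqP/coded_hull_injective.
exact: hull_conf_hull_set.
Unshelve. all: by end_near. Qed.

Definition solution_lamination : set (set conf) :=
  [set G | [/\ lamination G, rotation_vector omega G & G `<=` [set x | is_solution x]]].

Lemma coded_lamination_lamination p : simplex p -> solution_lamination (coded_lamination p).
Proof.
move=> hp; have hu := coded_hull_hull_function hp; split; last exact: coded_lamination_solution.
  split; first split.
  - by exists (hull_conf (coded_hull p) 0); exact: hull_conf_hull_set.
  - by apply/orderedP => x y; exact: hull_set_comparable.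
  - exact: hull_set_invariant.
  - exact: closed_closure.
  split; first exact: (hull_set_minimal omega_irr).
  exists (coded_lamination p).
    split; first exact: coded_lamination_perfect.
    apply: hull_set_zero_dimensional => //; first exact: coded_lamination_solution.
    exact: coded_lamination_in_wells.
  by exists id, id; split => // x; exact: cvg_id.
move=> x i px; have [t tx] := hull_set_at_phase hu px.
exact: at_phase_rotation hu tx.
Qed.

Section ProportionsOfHull.
Variables (u phi : R -> R).
Hypothesis hu : hull_function u.
Hypothesis hphi : hull_function phi.
Hypothesis phi_lattice : forall s, lattice (phi s).
Hypothesis phi_near : forall s, `|u s - phi s| <= del.

Let ind a s := bump del (u s - m a).

Lemma ind_measurable a : measurable_fun [set: measurableTypeR R] (ind a).
Proof.
apply: (@measurableT_comp _ _ _ _ _ _ (fun r => bump del (r - m a))).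
  apply: continuous_measurable_fun => r.
  apply: (@continuous_comp _ _ _ (fun r => r - m a) (bump del)).
    by apply: cvgB; [exact: cvg_id|exact: cvg_cst].
  exact: bump_continuous.
exact: hull_function_measurable.
Qed.

Lemma ind_value s : exists2 a, phi s - m a \is a Num.int &
  forall b, ind b s = (b == a)%:R.
Proof.
have [a ha] := phi_lattice s; have /intrP[l la] := ha; exists a => // b.
have := phi_near s; have del0 := del_gt0; rewrite /ind.
have [->|ba] := eqVneq b a => us.
  by apply: (bump1 (k := l)) => //; rewrite -la; congr (_ <= _) : us; congr (`|_|); ring.
rewrite eq_sym in ba; apply: bump0 => //.
have := minima_distance ba; rewrite -(int_dist_shift _ l).
have := int_dist_lipschitz (m a - m b + l%:~R) (u s - m b).
have -> : m a - m b + l%:~R - (u s - m b) = - (u s - phi s) by rewrite -la; ring.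
by rewrite normrN; lra.
Qed.

(** A bump of radius [del] around [m a] is [1] on the part of the circle that a
    lamination of solutions visits near [m a] and [0] near the other minima, so
    this integral is the measure of a well although the bump is continuous. *)
Definition proportions G : 'rV[R]_N :=
  \row_a integrate (lamination_measure omega G) (circle_bump del (m a)).

Lemma proportions_hull_set : proportions (hull_set u) = weights ind.
Proof.
apply/rowP => a; rewrite !mxE integrate_lamination_measure//.
by apply: eq_Rintegral => s _; rewrite circle_bumpE.
Qed.

Lemma proportions_simplex : simplex (proportions (hull_set u)).
Proof.
by rewrite proportions_hull_set; apply: weights_simplex ind_measurable ind_value.
Qed.

(** The proportions give back the function [phi] of the minima visited, up to a
    translation of the phase, and a solution is determined by the minima that it
    visits. *)
Lemma hull_set_proportions : hull_set u `<=` [set x | is_solution x] ->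
  hull_set u = coded_lamination (proportions (hull_set u)).
Proof.
move=> u_sol; have hp := proportions_simplex; set p := proportions _ in hp *.
have [c0 phiE] : exists c0, forall s, phi s = step_hull p (s + c0).
  rewrite /p proportions_hull_set; exact: hull_function_weights hphi ind_measurable ind_value.
have E t : hull_conf u t = hull_conf (coded_hull p) (t + c0).
  rewrite hull_conf_coded_hull//; apply: (coded_unique (symbol_self (t + c0) hp)).
    by apply: u_sol; exact: hull_conf_hull_set.
  by move=> k; rewrite /hull_conf addrAC -phiE; exact: phi_near.
congr closure; apply/seteqP; split=> _ [t _ <-].
  by exists (t + c0).
by exists (t - c0) => //; rewrite E subrK.
Qed.

End ProportionsOfHull.

Lemma proportions_coded_lamination p :
  (forall a b, a != b -> m a - m b \isn't a Num.int) -> simplex p ->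
  proportions (coded_lamination p) = p.
Proof.
move=> m_distinct hp; have hu := coded_hull_hull_function hp.
have hl s : lattice (step_hull p s) by exact: step_hull_lattice.
have hn s := coded_hull_near s hp.
rewrite proportions_hull_set//; apply: (weights_step_hull (m := m)) => //.
  by move=> a; exact: ind_measurable.
by move=> s; exact: (ind_value hl hn).
Qed.

Lemma near_lattice_hull_function u phi : hull_function u ->
  (forall s, lattice (phi s)) -> (forall s, `|u s - phi s| <= del) -> hull_function phi.
Proof.
move=> [u_homo u1 u_left] hl hn; have del0 := del_gt0; split.
- move=> s t st; rewrite leNgt; apply/negP => ts.
  have := hn s; have := hn t; have := u_homo _ _ st; rewrite !ler_norml.
  move=> h /andP[? ?] /andP[? ?].
  suff E : phi s = phi t by rewrite E ltxx in ts.
  by apply: lattice_separated => //; rewrite ltr_norml; apply/andP; split; lra.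
- move=> s; apply: (near_lattice_unique (v := u (s + 1))) => //.
    have [a /intrP[l la]] := hl s; exists a.
    by rewrite addrAC la rpredD ?intr_int ?rpred1.
  by rewrite u1 opprD addrACA subrr addr0.
- move=> s e e0; have [t ts ut] := u_left s del del0; exists t => //.
  suff -> : phi t = phi s by lra.
  apply: lattice_separated => //; have := hn s; have := hn t.
  have := u_homo _ _ (ltW ts); rewrite ltr_norml !ler_norml => ? /andP[? ?] /andP[? ?].
  by apply/andP; split; lra.
Qed.

(** Perfectness is assumed of a homeomorphic copy of [G], and an isolated point
    of [G] would be isolated in the copy. *)
Lemma lamination_perfect G x i e : lamination G -> G x -> 0 < e ->
  exists y, [/\ G y, y <> x & `|y i - x i| < e].
Proof.
move=> [_ [_ [C [[_ C_perf] _] [f [g [fK gK cf cg]]]]]] Gx e0.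
pose x' : G := SigSub (mem_set Gx).
pose near_x : set conf := [set y | `|y i - x i| < e].
have gx : set_val (g (f x')) = x by rewrite fK.
have : nbhs (f x') [set w | near_x (set_val (g w))].
  apply: (cg (f x') (set_val @^-1` near_x)).
  apply: (@initial_continuous _ _ (set_val : G -> conf) (g (f x')) near_x).
  rewrite gx; apply: (@ptws_proj_continuous R _ i x [set t | `|t - x i| < e]).
  apply/nbhs_ballP; exists e => //= t; rewrite /ball/= distrC; exact.
move=> [_ [[W oW <-] /= Wfx sW]].
have : limit_point C (set_val (f x')) by rewrite C_perf; exact: set_valP.
move=> /(_ W) []; first exact: open_nbhs_nbhs.
move=> w [wf Cw Ww]; pose w' : C := SigSub (mem_set Cw).
exists (set_val (g w')); split.
- exact: set_valP.
- rewrite -gx => /val_inj /(can_inj gK) E; move/eqP: wf; apply.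
  by rewrite -E.
- by apply: (sW w').
Qed.

Lemma solution_lamination_in_wells G x : solution_lamination G -> G x -> in_wells x.
Proof.
move=> [G_lam G_rot G_sol] Gx k; have [[_ G_ord G_inv G_closed] [G_min _]] := G_lam.
have GE := ordered_minimal_hull_set omega_irr G_ord G_inv G_rot Gx G_closed G_min.
have hu := hull_of_hull_function omega_irr G_ord G_inv G_rot Gx.
apply: (solution_near_lattice (G := G) (t := x k - dotp k)) => //.
- exact: (orderedP G).1.
- move=> e e0; exact: lamination_perfect.
- move=> y Gy xy; apply: (hull_set_band hu); rewrite -?GE//.
  by apply: le_trans xy _; rewrite ler1n.
Qed.

(** Rounding the hull function of the lamination to the nearest minima gives the
    function [phi]; the separation of the minima makes it monotone. *)
Lemma solution_lamination_hull G : solution_lamination G -> exists u phi,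
  [/\ G = hull_set u, hull_function u, hull_function phi,
      forall s, lattice (phi s) & forall s, `|u s - phi s| <= del].
Proof.
move=> GL; have [G_lam G_rot G_sol] := GL.
have [[[x Gx] G_ord G_inv G_closed] [G_min _]] := G_lam.
have GE := ordered_minimal_hull_set omega_irr G_ord G_inv G_rot Gx G_closed G_min.
have hu := hull_of_hull_function omega_irr G_ord G_inv G_rot Gx.
set u := hull_of omega x in GE hu.
have near_u s : {r | lattice r /\ `|u s - r| <= del}.
  apply: cid; have Gs : G (hull_conf u s) by rewrite GE; exact: hull_conf_hull_set.
  have [r lr] := solution_lamination_in_wells GL Gs 0.
  by rewrite /hull_conf dotp0 addr0 => ur; exists r.
pose phi s := sval (near_u s).
have hl s : lattice (phi s) by have [] := svalP (near_u s).
have hn s : `|u s - phi s| <= del by have [] := svalP (near_u s).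
by exists u, phi; split => //; exact: near_lattice_hull_function hu hl hn.
Qed.

Lemma solution_lamination_simplex G : solution_lamination G -> simplex (proportions G).
Proof.
by move=> /solution_lamination_hull[u [phi [-> hu hphi hl hn]]]; exact: proportions_simplex hu hl hn.
Qed.

Lemma solution_lamination_coded G : solution_lamination G ->
  coded_lamination (proportions G) = G.
Proof.
move=> GL; have [_ _] := GL.
have [u [phi [-> hu hphi hl hn]]] := solution_lamination_hull GL => G_sol.
by rewrite -(hull_set_proportions hu hphi hl hn G_sol).
Qed.

Section Parametrisation.
Hypothesis m_distinct : forall a b, a != b -> m a - m b \isn't a Num.int.

Let space : topologicalType :=
  initial_topology (fun G : solution_lamination => lamination_measure omega (set_val G)).

Definition lamination_proportions (G : space) : simplex :=
  SigSub (mem_set (solution_lamination_simplex (set_valP (G : solution_lamination)))).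

Definition lamination_of (p : simplex) : space :=
  (SigSub (mem_set (coded_lamination_lamination (set_valP p))) : solution_lamination).

Lemma lamination_proportionsK : cancel lamination_proportions lamination_of.
Proof.
move=> G; apply: val_inj; rewrite /=; apply: solution_lamination_coded.
exact: (set_valP (G : solution_lamination)).
Qed.

Lemma lamination_ofK : cancel lamination_of lamination_proportions.
Proof.
move=> p; apply: val_inj; rewrite /=; apply: proportions_coded_lamination => //.
exact: set_valP.
Qed.

Lemma proportion_continuous f :
  continuous (fun G : space => integrate (lamination_measure omega (set_val (G : solution_lamination))) f).
Proof.
pose h (G : space) := lamination_measure omega (set_val (G : solution_lamination)).
have ch : continuous h by exact: initial_continuous.
have ci : continuous (fun mu : vague_measures R => integrate mu) by exact: initial_continuous.
move=> G; apply: (@continuous_comp _ _ _ h (fun mu : vague_measures R => integrate mu f)).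
  exact: ch.
exact: (ptws_continuousP (fun mu : vague_measures R => integrate mu)).1 ci f _.
Qed.

Lemma lamination_proportions_continuous : continuous lamination_proportions.
Proof.
apply: continuous_comp_initial.
by apply: row_continuous => a; exact: proportion_continuous.
Qed.

Let integral_hull (f : continuousType (circle R) R) p := \int[mu]_(s in `[0, 1]) f (to_circle (coded_hull p s)).

(** The phases at which some coordinate of the step function sits at a jump. *)
Lemma exceptional_phases_countable p :
  countable [set s | exists k r, s + dotp k = step_cdf m p r].
Proof.
apply: (@sub_countable _ _ _ (\bigcup_k ((fun s => s - dotp k) @` range (step_cdf m p)))).
  apply: subset_card_le => s [k [r E]]; exists k => //; exists (step_cdf m p r); first by exists r.
  by rewrite -E addrK.
apply: bigcup_countable => [|k _]; first exact: countableP.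
by apply: (sub_countable (card_image_le _ _)); exact: countable_step_cdf.
Qed.

Lemma integral_hull_cvg (f : continuousType (circle R) R) (p_ : nat -> 'rV[R]_N) p : (forall b, simplex (p_ b)) -> simplex p ->
  (forall a, p_ b ord0 a @[b --> \oo] --> p ord0 a) ->
  integral_hull f (p_ b) @[b --> \oo] --> integral_hull f p.
Proof.
move=> hp_ hp pcvg; have del0 := del_gt0.
have [C fC] := circle_fun_bounded f.
have hcvg s : (forall k r, s + dotp k <> step_cdf m p r) ->
    f (to_circle (coded_hull (p_ b) s)) @[b --> \oo] --> f (to_circle (coded_hull p s)).
  move=> s_reg; apply: (@cvg_comp _ _ _ (fun b => coded_hull (p_ b) s) (f \o @to_circle R)
    \oo (nbhs (coded_hull p s))); last exact: circle_fun_continuous.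
  apply: (@coded_hull_cvg nat \oo _ p p_ s (fun=> s)) => // [|k].
    by near=> b; rewrite subrr normr0.
  apply: (@step_hull_stable R N m nat \oo _ p_ p (s + dotp k) (3 * del)) => //; lra.
pose hE q s := (f (to_circle (coded_hull q s)))%:E.
have mE q : simplex q -> measurable_fun [set: measurableTypeR R] (fun s => f (to_circle (coded_hull q s))).
  move=> hq; exact: measurableT_comp (measurable_circle_fun f) (measurable_circle_hull (coded_hull_hull_function hq)).
have intE q : simplex q -> mu.-integrable `[0%R, 1%R]%classic (hE q).
  move=> hq; apply: (@bounded_itv_integrable _ (fun s => f (to_circle (coded_hull q s))) C) => //.
    exact: mE.
  exact: segment_finite.
have [|||||_ _ cv] := @dominated_convergence _ (measurableTypeR R) R mu `[0%R, 1%R]%classic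
  (measurable_itv _) (fun b => hE (p_ b)) (hE p) (fun=> C%:E).
- by move=> b; have /integrableP[] := intE _ (hp_ b).
- by have /integrableP[] := intE _ hp.
- pose E := [set s | exists k r, s + dotp k = step_cdf m p r].
  have mE0 : measurable (E : set (measurableTypeR R)).
    exact/countable_measurable/exceptional_phases_countable.
  have E0 : mu E = 0 by exact/countable_lebesgue_measure0/exceptional_phases_countable.
  exists E; split => // s /= hs; apply: contrapT => s_reg; apply: hs => _.
  apply: cvg_EFin; first by near=> b.
  by apply: hcvg => k r Esr; apply: s_reg; exists k, r.
- by apply: (@bounded_itv_integrable _ (fun=> C) `|C|) => //; exact: segment_finite.
- by apply: aeW => s b _; rewrite /hE lee_fin.
apply: fine_cvg; rewrite fineK//; exact: integrable_fin_num (intE _ hp).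
Unshelve. all: by end_near. Qed.

Lemma lamination_of_continuous : continuous lamination_of.
Proof.
apply: continuous_comp_initial.
apply: (@continuous_comp_initial _ _ _ (@integrate R)).
apply/ptws_continuousP => f.
rewrite [X in continuous X](_ : _ = integral_hull f \o set_val).
  apply: (row_seq_continuous (Q := simplex)) => [p|a p|].
  - exact: set_valP.
  - apply: (@continuous_comp _ _ _ (set_val : simplex -> 'rV[R]_N) (fun v => v ord0 a)).
      exact: initial_continuous.
    exact: coord_continuous.
  - exact: integral_hull_cvg.
apply/funext => p; rewrite /= integrate_lamination_measure//.
by apply: coded_hull_hull_function; exact: set_valP.
Qed.

Lemma laminations_homeomorphic_simplex : homeomorphic space simplex.
Proof.
exists lamination_proportions, lamination_of; split.
- exact: lamination_proportionsK.
- exact: lamination_ofK.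
- exact: lamination_proportions_continuous.
- exact: lamination_of_continuous.
Qed.

End Parametrisation.

End Solutions.

(** * The size of the perturbation *)

Theorem theorem1p2 (R : realType) (d : nat) (d_gt0 : (0 < d)%N)
  (V : R -> R) (N : nat)
  (V_C2 : C2_real V) (V_periodic : periodic V 1) (V_Morse : Morse V)
  (V_minima : has_N_minima V N)
  (S : 'rV[int]_d -> config R d -> R)
  (S_A : cond_A S) (S_B : cond_B S) (S_C : cond_C S)
  (omega : 'rV[R]_d) (omega_irr : irrational_vector omega) :
  exists2 eps1 : R, 0 < eps1 &
    forall eps : R, 0 < eps <= eps1 ->
      homeomorphic (lamination_space omega V S eps) (simplex R N).
Proof.
have [V_der V1_der V2_cont] := V_C2.
have [m [m_min m_distinct m_all]] := V_minima.
have dV (t : R) : is_derive t (1 : R) V (derive1 V t).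
  by apply: DeriveDef; [exact: V_der|rewrite derive1E].
have dV1 (t : R) : is_derive t (1 : R) (derive1 V) (derive1n 2 V t).
  by apply: DeriveDef; [exact: V1_der|rewrite derive1nS derive1E].
have V1_shift t (l : int) : derive1 V (t + l%:~R) = derive1 V t.
  exact: derive1_periodic.
have V2_shift t (l : int) : derive1n 2 V (t + l%:~R) = derive1n 2 V t.
  by apply: (@derive1_periodic R (derive1 V)) => s; exact: (V1_shift s 1).
have [del [c [eta [K [del_itv c_gt0 eta_gt0 K_ge0 [minima_dist sep well gap V2_le]]]]]] :=
  potential_constants dV dV1 V2_cont V1_shift V2_shift V_Morse m_min m_distinct m_all.
have V1_lattice r : lattice m r -> derive1 V r = 0.
  by move=> /(lattice_local_minimum dV dV1 V2_cont V1_shift V2_shift V_Morse m_min)[].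
have L_ge0 : 0 <= 4 + spread m.
  by apply: addr_ge0 => //; apply: sumr_ge0 => a _.
have [B B_ge0 force_bound] := force_bounded S_A S_B omega L_ge0.
have [n [A [n_gt0 A_ge0 force_diff]]] := force_mean_value S_A S_B S_C omega L_ge0.
pose size0 : R := (size (ball_seq n (0 : 'rV[int]_d)))%:R.
pose D := B + size0 * A + 1.
have sA_ge0 : 0 <= size0 * A by rewrite mulr_ge0.
have D_gt0 : 0 < D by rewrite /D; lra.
have /andP[del_gt0 _] := del_itv.
(* All the smallness conditions on [eps] have a factor bounded by [D]. *)
exists (Num.min eta (Num.min (c * del) (c / 2)) / D).
  by rewrite divr_gt0// !lt_min eta_gt0 mulr_gt0//= divr_gt0.
move=> eps /andP[eps_gt0]; rewrite ler_pdivlMr// !le_min => /and3P[eps_eta eps_well eps_c].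
have epsD x : x <= D -> eps * x <= eps * D by move=> xD; rewrite ler_pM2l.
apply: (laminations_homeomorphic_simplex (V1 := derive1 V) (V2 := derive1n 2 V) (del := del)
  (c := c) (eta := eta) (K := K) (L := 4 + spread m) (A := A) (B := B) (n := n)) => //.
- exact: V1_lattice.
- exact: sep.
- exact: well.
- exact: gap.
- by apply: le_trans eps_eta; apply: epsD; rewrite /D; lra.
- by apply: le_trans eps_well; apply: epsD; rewrite /D; lra.
- by apply: le_trans eps_c; apply: epsD; rewrite /D -/size0; lra.
Qed.
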